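(* Let $w\in S_n$, let $T$ be an inversions tableau of shape $w$, and let $1\le i<j\le n$. Then $C_{ij}$ is a chute move on the inversions tableau $T$ if and only if $C_{ij}$ is a chute move on the pipe dream $\phi^{-1}(T)$. Further, in this case $\phi^{-1}(C_{ij}T)=C_{ij}(\phi^{-1}(T))$ (that is, whenever $T'$ is an inversions tableau of shape $w$ with $T'=C_{ij}T$, the pipe dream $\phi^{-1}(T')$ is the result of applying $C_{ij}$ to $\phi^{-1}(T)$).
   Context: Inversions tableaux. For $w=w_1\cdots w_n\in S_n$, $\mathrm{Inv}(w)=\{(i,j): i<j,\ w_j<w_i\}$. The staircase consists of the boxes $(i,j)$, $1\le i<j\le n$ (row $i$, column $j$); box $(i,j)$ is shaded if $(i,j)\in\mathrm{Inv}(w)$. An inversions tableau of shape $w$ assigns a number $T(i,j)\in\{1,\dots,n\}$ to each shaded box, with $T(i,j)=0$ for unshaded boxes, such that: (IT1) for all $i<j$, $T(i,j)$ is the median (counting multiplicities) of the entries in the hook $\{(i,j)\}\cup\{(i',j): i<i'<j\}\cup\{(i,j'): i<j'<j\}$; (IT2) no two shaded boxes in the same column have the same entry; (IT3) $T(i,i+1)\le i$ for all $1\le i<n$. $\mathcal{IT}(w)$ is the set of these. Pipe dreams. Index the squares of an $n\times n$ grid by matrix coordinates (row, column). A pipe dream for $w$ tiles each square $(r,c)$ with $r+c=n+1$ by an elbow joining its left edge to its top edge, and each square with $r+c<n+1$ either by a bump tile (two elbows: left edge to top edge, and bottom edge to right edge) or by a cross tile (a horizontal and a vertical strand crossing), so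 that for each $p$ the pipe entering from the left in row $p$ (pipe $p$) exits at the top in column $w_p$. It is reduced if no two pipes cross more than once; $\mathcal{RP}(w)$ is the set of reduced pipe dreams for $w$. In $P\in\mathcal{RP}(w)$, pipes $i<j$ cross exactly if $(i,j)\in\mathrm{Inv}(w)$. The map $\phi:\mathcal{RP}(w)\to\mathcal{IT}(w)$ is the bijection sending $P$ to the tableau $T$ where, for $(i,j)\in\mathrm{Inv}(w)$, $T(i,j)$ is the row in which pipes $i$ and $j$ cross in $P$. Chute moves on pipe dreams. For $i<j$, $C_{ij}$ is a chute move on $P\in\mathcal{RP}(w)$ (between rows $a$ and $b$) if there are rows $a<b$ and columns $c<d$ such that: the tiles $(a,c)$ and $(b,c)$ are bump tiles; the tile $(b,d)$ is not a cross (it is a bump tile, or a single elbow if $b+d=n+1$); all other tiles in the rectangle of rows $a,\dots,b$ and columns $c,\dots,d$ are crosses (in particular $(a,d)$ is a cross); pipe $i$ is the left-to-top elbow of tile $(b,c)$ and pipe $j$ is the bottom-to-right elbow of tile $(b,c)$ (so $i$ runs up column $c$ and then right along row $a$, $j$ runs right along row $b$ and then up column $d$, and they cross at $(a,d)$). The result $C_{ij}P$ is obtained from $P$ by replacing the cross at $(a,d)$ with a bump tile and the bump tile at $(b,c)$ with a cross. The rectangle is determined by $P,i,j$. Chute moves on inversions tableaux. For $T,T'\in\mathcal{IT}(w)$ and $i<j$ with $T(i,j)=a$, we say $T'=C_{ij}T$, and that $C_{ij}$ is a chute move on $T$, if: 1. $T'(i,j)=b$, where $b$ is the smallest number with $b>a$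 and $b\notin\{T(r,j): r<i\}$; 2. for some (possibly empty) set of values $k>j$, $T(i,k)=a=T'(j,k)$ and $T(j,k)=b=T'(i,k)$; 3. for all other pairs $(h,l)$ (not $(i,j)$ and not $(i,k),(j,k)$ for the values of $k$ in 2), $T(h,l)=T'(h,l)$. $C_{ij}$ is a chute move on $T$ if such a $T'\in\mathcal{IT}(w)$ exists. *)

(* Defs.v *)
From mathcomp Require Import all_boot all_fingroup all_algebra.

Set Implicit Arguments.
Unset Strict Implicit.
Unset Printing Implicit Defensive.

(* Indices (positions of w, pipes, rows, columns) are elements of 'I_n, that
   is, they are numbered from 0.  Entries of tableaux are natural numbers that
   keep the usual numbering of rows from 1, because 0 is the entry of an
   unshaded box. *)

Definition is_inversion n (w : 'S_n) (i j : 'I_n) : bool := (i < j) && (w j < w i).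

(* Only used on sequences of odd size. *)
Definition median (s : seq nat) : nat := nth 0 (sort leq s) (size s)./2.

Definition hook_entries n (T : 'M[nat]_n) (i j : 'I_n) : seq nat :=
  T i j :: [seq T k j | k : 'I_n <- enum 'I_n & i < k < j]
        ++ [seq T i k | k : 'I_n <- enum 'I_n & i < k < j].

(* The positions of the matrix on or below the diagonal are not boxes of the
   staircase; [it_unshaded] sets them to 0 together with the unshaded boxes. *)
Record inversions_tableau n (w : 'S_n) (T : 'M[nat]_n) : Prop := {
  it_unshaded : forall i j, ~~ is_inversion w i j -> T i j = 0;
  it_shaded : forall i j, is_inversion w i j -> 1 <= T i j <= n;
  it_median : forall i j : 'I_n, i < j -> T i j = median (hook_entries T i j);
  it_column : forall i i' j, is_inversion w i j -> is_inversion w i' j ->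
    i != i' -> T i j != T i' j;
  (* T(i,i+1) <= i when rows are numbered from 1 *)
  it_flag : forall i j : 'I_n, j = i.+1 :> nat -> T i j <= i.+1 }.

(* A tiling of the grid is given by the set of its cross tiles.  With indices
   from 0, the staircase squares r + c < n + 1 are those with r + c + 1 < n, and
   the antidiagonal r + c = n + 1 is r + c + 1 = n. *)
Definition pipedream n := {set 'I_n * 'I_n}.

Definition is_bump n (P : pipedream n) (r c : 'I_n) : bool :=
  ((r, c) \notin P) && ((r + c).+1 < n).

Definition is_elbow n (P : pipedream n) (r c : 'I_n) : bool :=
  ((r, c) \notin P) && ((r + c).+1 == n).

(* (true, (r, c)) : a pipe enters the tile (r, c) through its left edge;
   (false, (r, c)) : a pipe enters the tile (r, c) through its bottom edge. *)
Definition entry n := (bool * ('I_n * 'I_n))%type.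

(* A pipe leaves a tile through the top edge if it entered from the left at a
   bump or an elbow, or from the bottom at a cross; otherwise it leaves
   through the right edge. *)
Definition exits_up n (P : pipedream n) (s : entry n) : bool :=
  s.1 (+) (s.2 \in P).

Definition next_entry n (P : pipedream n) : rel (entry n) := fun s t =>
  let: (_, (r, c)) := s in
  let: (from_left, (r', c')) := t in
  if exits_up P s then [&& ~~ from_left, r == r'.+1 :> nat & c' == c]
  else [&& from_left, r' == r & c' == c.+1 :> nat].

Definition first_col n (p : 'I_n) : 'I_n :=
  Ordinal (leq_ltn_trans (leq0n p) (ltn_ord p)).

Definition pipe_enters n (P : pipedream n) (p : 'I_n) (s : entry n) : bool :=
  connect (next_entry P) (true, (p, first_col p)) s.

Definition pipe_exits_top n (P : pipedream n) (p c : 'I_n) : Prop :=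
  exists s : entry n,
    [/\ pipe_enters P p s, s.2.1 = 0 :> nat, s.2.2 = c & exits_up P s].

Definition pipes_cross n (P : pipedream n) (i j : 'I_n) (x : 'I_n * 'I_n) :
    bool :=
  (x \in P) && (pipe_enters P i (true, x) && pipe_enters P j (false, x)
             || pipe_enters P i (false, x) && pipe_enters P j (true, x)).

Record reduced_pipedream n (w : 'S_n) (P : pipedream n) : Prop := {
  pd_staircase : forall r c, (r, c) \in P -> (r + c).+1 < n;
  pd_exits : forall p, pipe_exits_top P p (w p);
  pd_reduced : forall i j x y, i != j ->
    pipes_cross P i j x -> pipes_cross P i j y -> x = y }.

Definition phi_entry n (w : 'S_n) (P : pipedream n) (i j : 'I_n) : nat :=
  if is_inversion w i j then
    if [pick x | pipes_cross P i j x] is Some (r, _) then r.+1 else 0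
  else 0.

Definition phi n (w : 'S_n) (P : pipedream n) : 'M[nat]_n :=
  (\matrix_(i, j) phi_entry w P i j)%R.

Definition chute_rectangle n (P : pipedream n) (i j a b c d : 'I_n) : Prop :=
  [/\ a < b /\ c < d,
      is_bump P a c /\ is_bump P b c,
      is_bump P b d || is_elbow P b d,
      forall r s : 'I_n, a <= r <= b -> c <= s <= d ->
        (r, s) \notin [:: (a, c); (b, c); (b, d)] -> (r, s) \in P
    & pipe_enters P i (true, (b, c)) /\ pipe_enters P j (false, (b, c))].

(* P' = C_ij P *)
Definition pipedream_chute n (i j : 'I_n) (P P' : pipedream n) : Prop :=
  i < j /\ exists a b c d, chute_rectangle P i j a b c d /\
    P' = (b, c) |: (P :\ (a, d)).

Definition is_pipedream_chute n (i j : 'I_n) (P : pipedream n) : Prop :=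
  exists P', pipedream_chute i j P P'.

Definition smallest_free n (T : 'M[nat]_n) (i j : 'I_n) (a b : nat) : Prop :=
  let free m := a < m /\ forall r : 'I_n, r < i -> T r j <> m in
  free b /\ forall m, free m -> b <= m.

(* T' = C_ij T *)
Definition tableau_chute n (i j : 'I_n) (T T' : 'M[nat]_n) : Prop :=
  let a := T i j in
  let b := T' i j in
  [/\ i < j, smallest_free T i j a b
    & exists K : {set 'I_n},
        (forall k, k \in K ->
           [/\ j < k, T i k = a, T' j k = a, T j k = b & T' i k = b]) /\
        (forall h l, (h, l) <> (i, j) ->
           ~ ((h = i \/ h = j) /\ l \in K) -> T h l = T' h l)].

Definition is_tableau_chute n (w : 'S_n) (i j : 'I_n) (T : 'M[nat]_n) : Prop :=
  exists2 T', inversions_tableau w T' & tableau_chute i j T T'.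

(* Main.v *)
Require Import Defs.
From mathcomp Require Import all_boot all_fingroup all_algebra.
From mathcomp Require Import zify.

(** Two labellings translate the picture into recursions: [left_pipe r c] is
    the pipe that enters the tile (r, c) through its left edge, and
    [top_pipe r c] is the one that leaves it through its top edge.  Sweep the
    staircase from the bottom row to the top one, each row from left to right.
    The pipes met by the moving cut form a sequence, and a cross exchanges two
    neighbours of it.  Pipes p < q of a reduced pipe dream cross at most once,
    so they are in their initial order as long as they have not crossed, and in
    the opposite order afterwards ([front_sortedP]).  As T = phi P records the
    crossing rows, T determines the order of the pipes along the top of each
    row ([phi_order]).  This has two consequences.
    - Orders are transitive, so T(p, q) lies between T(p, k) and T(k, q) for
      p < k < q.  An induction on q - p shows that this condition on triples is
      equivalent to the median condition on hooks ([triple_hook_median],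
      [hook_triple_median]).  Hence phi P is an inversions tableau
      ([phi_tableau]), and triples can be used for all inversions tableaux.
    - A tile is a cross exactly if the same pipe leaves the top of the tile and
      the top of the tile below it, so phi is injective ([phi_inj]).

    From pipe dreams to tableaux: a chute move only exchanges the pipes i and j
    along the boundary of its rectangle.  The involution [mirror], which
    exchanges opposite sides of that boundary, maps the crosses of the new
    pipe dream to the crosses of the old one and preserves the pair of pipes at
    each cross ([crossing_mirror]).  So the new pipe dream is reduced, and the
    only pairs whose row changes are (i, j) and the pairs (i, k), (j, k) with k
    one of the pipes that traverse the rectangle vertically ([chute_phi]).

    From tableaux to pipe dreams: let T' = C_ij T, with a = T(i, j) and
    b = T'(i, j).  Both tableaux satisfy the condition on triples although they
    disagree at (i, j), and this is very restrictive.  Each row strictly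
    between a and b is the row in which j crosses some h < i; the triples
    (h, i, j) of T and of T' bound T(h, i) on either side, so h crosses i in
    that row as well.  If k crosses i in row a to the left of j, then the
    triples of T' put k in the set K of the move, so that k crosses j in row b,
    and the triples (h, i, k) show that h crosses k in the same row as i and j.
    Therefore i, j and all these k go straight up between rows a and b, and
    these crosses fill the rectangle ([tableau_chute_rectangle]).

    The triples also determine K, hence T', from T ([tableau_chute_uniq]).  So
    phi maps the result of the move on P to T', and since phi is injective no
    other reduced pipe dream is mapped to T'. *)

Set Implicit Arguments.
Unset Strict Implicit.
Unset Printing Implicit Defensive.

(** * Hooks and triples *)

Lemma nth_sorted_leq t k v : sorted leq t -> k < size t ->
  (nth 0 t k <= v) = (k < count (leq^~ v) t).
Proof.
elim: t k => [//|x t IHt] k /= srt.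
have lex : all (leq x) t by apply: order_path_min srt; apply: leq_trans.
have cnt0 : v < x -> count (leq^~ v) t = 0.
  move=> ltvx; apply/eqP; rewrite -leqn0 leqNgt -has_count;
    apply/hasP => -[y yt].
  by have := allP lex _ yt; lia.
case: k => [_|k ltk] /=; first by case: (leqP x v) => [_|/cnt0 ->].
rewrite IHt ?(path_sorted srt) //.
by case: (leqP x v) => [_|/cnt0 ->]; rewrite ?add1n ?ltnS // !ltn0.
Qed.

Lemma median_leq s v : 0 < size s ->
  (median s <= v) = ((size s)./2 < count (leq^~ v) s).
Proof.
move=> s0; rewrite /median nth_sorted_leq ?size_sort ?sort_sorted //.
- by rewrite (seq.permP (permEl (perm_sort leq s))).
- exact: leq_total.
by rewrite ltn_half_double -addnn; lia.
Qed.

(** The entries of a hook other than its corner come in pairs, one entry in the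
    column and one in the row for each index of [L].  Counting the entries that
    are at most [v] therefore amounts to comparing, over [L], the pairs that
    are entirely below [v] with those that are entirely above. *)
Section MedianOfPairs.

Variables (I : eqType) (L : seq I) (f g : I -> nat).

Let hook x := x :: map f L ++ map g L.

Lemma hook_median_leq x v :
  (median (hook x) <= v) =
  (size L < (x <= v) + (count (fun k => f k <= v) L
                        + count (fun k => g k <= v) L)).
Proof.
rewrite median_leq //= count_cat !count_map size_cat !size_map.
by have -> : uphalf (size L + size L) = size L by lia.
Qed.

Lemma median_between x :
    {in L, forall k, minn (f k) (g k) <= x <= maxn (f k) (g k)} ->
  median (hook x) = x.
Proof.
move=> btw; suff le v : (median (hook x) <= v) = (x <= v).
  by apply/eqP; rewrite eqn_leq le leqnn -le leqnn.
rewrite hook_median_leq -count_predUI; case: (leqP x v) => [lexv|ltvx].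
  have -> : count (predU (fun k => f k <= v) (fun k => g k <= v)) L = size L.
    by apply/eqP; rewrite -all_count; apply/allP => k /btw /=; lia.
  by lia.
have -> : count (predI (fun k => f k <= v) (fun k => g k <= v)) L = 0.
  apply/eqP; rewrite -leqn0 leqNgt -has_count; apply/hasP => -[k /btw /=]; lia.
by have := count_size (predU (fun k => f k <= v) (fun k => g k <= v)) L; lia.
Qed.

(** The entries at most [x] are a majority, so a pair that contributes none of
    them is compensated by a pair that contributes two. *)
Lemma median_above x k : median (hook x) = x -> k \in L ->
  x < f k -> x < g k -> exists2 l, l \in L & (f l <= x) && (g l <= x).
Proof.
move=> med kL fk gk; pose p k := f k <= x; pose q k := g k <= x.
suff : has (predI p q) L by case/hasP => l lL /= h; exists l.
have := hook_median_leq x x; rewrite med leqnn -(count_predUI p q) has_count.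
have : has (predC (predU p q)) L by apply/hasP; exists k => //=; rewrite /p /q;
  lia.
by rewrite has_count; have := count_predC (predU p q) L; lia.
Qed.

Lemma median_below x k : median (hook x) = x -> k \in L ->
  f k < x -> g k < x -> exists2 l, l \in L & (x <= f l) && (x <= g l).
Proof.
move=> med kL fk gk; pose p k := f k <= x.-1; pose q k := g k <= x.-1.
suff : has (predC (predU p q)) L.
  by case/hasP=> l lL; rewrite /= /p /q => h; exists l => //; lia.
have := hook_median_leq x x.-1; rewrite med -(count_predUI p q) has_count.
have -> : (x <= x.-1) = false by lia.
have : has (predI p q) L by apply/hasP; exists k => //=; rewrite /p /q; lia.
by rewrite has_count; have := count_predC (predU p q) L; lia.
Qed.

End MedianOfPairs.

Definition between a x y := minn x y <= a <= maxn x y.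

Definition triple_median n (T : 'M[nat]_n) := forall i k j : 'I_n,
  i < k < j -> between (T i j) (T i k) (T k j).

Definition hook_median n (T : 'M[nat]_n) := forall i j : 'I_n,
  i < j -> T i j = median (hook_entries T i j).

Lemma triple_hook_median n (T : 'M[nat]_n) : triple_median T -> hook_median T.
Proof.
move=> tm i j ltij; apply/esym/median_between => k.
by rewrite mem_filter => /andP [/tm]; rewrite /between minnC maxnC.
Qed.

(** By induction on [j - i].  If [k] violates the condition, with both entries
    of its pair on one side of [T i j], then some [l] has both entries of its
    pair on the other side.  The smaller triples inside (i, k, l, j) then put
    the entry of the pair {k, l} on both sides of [T i j]. *)
Lemma hook_triple_median n (T : 'M[nat]_n) : hook_median T -> triple_median T.
Proof.
move=> hm i k j; have [m] := ubnP (j - i).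
elim: m => // m IHm in i k j * => ltm /andP [ltik ltkj].
have /esym med := hm i j (ltn_trans ltik ltkj).
pose L := [seq l : 'I_n <- enum 'I_n | i < l < j].
have kL : k \in L by rewrite mem_filter ltik ltkj mem_enum.
have IHi (l1 l2 : 'I_n) : i < l1 < l2 -> l2 < j ->
    between (T i l2) (T i l1) (T l1 l2) by move=> h1 h2; apply: IHm; lia.
have IHj (l1 l2 : 'I_n) : i < l1 -> l1 < l2 < j ->
    between (T l1 j) (T l1 l2) (T l2 j) by move=> h1 h2; apply: IHm; lia.
have neq (l : 'I_n) : T k j != T l j -> l < k \/ k < l.
  by case: (ltngtP l k) => [||/val_inj ->]; rewrite ?eqxx //; [left | right].
rewrite /between; apply/andP; split; rewrite leqNgt; apply/negP => lt.
  have [l] := @median_above _ L (T^~ j) (T i) _ _ med kL (ltac:(lia) :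
    T i j < T k j) (ltac:(lia)).
  rewrite mem_filter => /andP [/andP [ltil ltlj] _] le.
  have [ltlk|ltkl] := neq l (ltac:(lia)).
    by have := IHi l k; have := IHj l k; rewrite /between; lia.
  by have := IHi k l; have := IHj k l; rewrite /between; lia.
have [l] := @median_below _ L (T^~ j) (T i) _ _ med kL (ltac:(lia) :
  T k j < T i j) (ltac:(lia)).
rewrite mem_filter => /andP [/andP [ltil ltlj] _] le.
have [ltlk|ltkl] := neq l (ltac:(lia)).
  by have := IHi l k; have := IHj l k; rewrite /between; lia.
by have := IHi k l; have := IHj k l; rewrite /between; lia.
Qed.

Section Tableau.

Variables (n : nat) (w : 'S_n) (T : 'M[nat]_n).
Hypothesis hT : inversions_tableau w T.

Lemma it_triple : triple_median T.
Proof. exact/hook_triple_median/(it_median hT). Qed.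

Lemma it_inversion i j : 0 < T i j -> is_inversion w i j.
Proof.
by move=> pos; apply/negPn/negP => /(it_unshaded hT) T0; rewrite T0 in pos.
Qed.

Lemma it_column_inj i i' j : 0 < T i j -> T i j = T i' j -> i = i'.
Proof.
move=> pos eqT; apply/eqP/negPn/negP => ne.
have := it_column hT (it_inversion pos) _ ne; rewrite -eqT eqxx => /(_ _) h.
by have : false by apply: h; apply: it_inversion; rewrite -eqT.
Qed.

(** The bound imposed next to the diagonal propagates along the row: [T i j]
    lies between [T i i.+1] and [T i.+1 j], where the second is at most [i.+2];
    and a nonzero entry differs from the others of its column. *)
Lemma it_row_bound (i j : 'I_n) : i < j -> T i j <= i.+1.
Proof.
have [m] := ubnP (j - i); elim: m => // m IHm in i j * => ltm ltij.
have [eqj|ltSj] : j = i.+1 :> nat \/ i.+1 < j by lia.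
  exact: it_flag hT _ _ eqj.
have ltSn : i.+1 < n by have := ltn_ord j; lia.
pose k := Ordinal ltSn.
have := @it_triple i k j; rewrite /between /= leqnn ltSj => /(_ isT).
have := it_flag hT (erefl : k = i.+1 :> nat).
have : T k j <= i.+2 by apply: (IHm k) => //=; lia.
case: (ltnP i.+1 (T i j)) => // gt h1 h2 h3.
have eqT : T i j = T k j by lia.
have pos : 0 < T i j by lia.
by have := it_column_inj pos eqT => /(congr1 val) /=; lia.
Qed.

End Tableau.

Lemma smallest_free_uniq n (T : 'M[nat]_n) (i j : 'I_n) a b b' :
  smallest_free T i j a b -> smallest_free T i j a b' -> b = b'.
Proof. by move=> [f1 m1] [f2 m2]; apply/eqP; rewrite eqn_leq m1 ?m2. Qed.

(** The value at (i, j) is determined by [T], so only the sets of columns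
    could differ.  If [k] belonged to the first and not to the second, then the
    second tableau would have equal entries at (i, j) and (j, k), and the
    smaller value [T i j] at (i, k), which must lie between them. *)
Lemma tableau_chute_uniq n (w : 'S_n) (T T1 T2 : 'M[nat]_n) (i j : 'I_n) :
    inversions_tableau w T1 -> inversions_tableau w T2 ->
  tableau_chute i j T T1 -> tableau_chute i j T T2 -> T1 = T2.
Proof.
move=> it1 it2 ch1 ch2.
have Eb : T1 i j = T2 i j.
  by case: ch1 ch2 => _ sf1 _ [_ sf2 _]; apply: smallest_free_uniq sf1 sf2.
have gtb : T i j < T1 i j by case: ch1 => _ [[]].
case: ch1 ch2 => ltij _ [K1 [inK1 out1]] [_ _ [K2 [inK2 out2]]].
have sub (S1 S2 : 'M[nat]_n) (J1 J2 : {set 'I_n}) :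
    inversions_tableau w S2 -> S1 i j = S2 i j -> T i j < S2 i j ->
    (forall k, k \in J1 -> [/\ j < k, T i k = T i j, S1 j k = T i j,
                               T j k = S1 i j & S1 i k = S1 i j]) ->
    (forall h l, (h, l) <> (i, j) -> ~ ((h = i \/ h = j) /\ l \in J2) ->
       T h l = S2 h l) -> J1 \subset J2.
  move=> itS Es gts inJ out; apply/subsetP => k /inJ [ltjk Tik _ Tjk _].
  apply/negPn/negP => nk.
  have eqik : T i k = S2 i k.
    apply: out; first by case=> eqkj; rewrite eqkj ltnn in ltjk.
    by case=> _; rewrite (negbTE nk).
  have eqjk : T j k = S2 j k.
    apply: out; first by case=> eqji; rewrite eqji ltnn in ltij.
    by case=> _; rewrite (negbTE nk).
  have := @it_triple _ _ _ itS i j k; rewrite ltij ltjk => /(_ isT).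
  by rewrite /between -eqik -eqjk; lia.
have EK : K1 = K2.
  by apply/eqP; rewrite eqEsubset (sub T1 T2) ?(sub T2 T1) // -Eb.
rewrite -{}EK in inK2 out2; apply/matrixP => h l.
case: ((h, l) =P (i, j)) => [[-> ->] //|ne].
case: (boolP (l \in K1)) => [lK|nlK]; last first.
  by rewrite -out1 // ?out2 // => -[_]; rewrite (negbTE nlK).
have [_ _ e1 _ e2] := inK1 l lK; have [_ _ e1' _ e2'] := inK2 l lK.
case: (h =P i) => [->|ni]; first by rewrite e2 e2'.
case: (h =P j) => [->|nj]; first by rewrite e1 e1'.
by rewrite -out1 // ?out2 // => -[[]].
Qed.

(** * Pipes through a tiling *)

Lemma downward_ind n (Q : nat -> Prop) :
  Q n -> (forall r, r < n -> Q r.+1 -> Q r) -> forall r, r <= n -> Q r.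
Proof.
move=> Qn QS r lern; rewrite -(subKn lern); elim: (n - r) => [|k IHk].
  by rewrite subn0.
case: (ltnP k n) => [ltkn|lenk]; last by have -> : n - k.+1 = n - k by lia.
by apply: QS; [lia | rewrite subnSK].
Qed.

(** Used to find the bump at which a run of crosses starts. *)
Lemma last_gap (p : pred nat) d :
  (forall s, s < d -> p s) \/
  exists c, [/\ c < d, ~~ p c & forall s, c < s < d -> p s].
Proof.
elim: d => [|d [all_p|[c [ltcd npc pc]]]]; first by left.
  have [pd|npd] := boolP (p d).
    by left=> s; rewrite ltnS leq_eqVlt => /orP [/eqP -> //|/all_p].
  by right; exists d; split=> // s; lia.
have [pd|npd] := boolP (p d); last by right; exists d; split=> // s; lia.
right; exists c; split=> //; first lia.
move=> s /andP [ltcs]; rewrite ltnS leq_eqVlt => /orP [/eqP -> //|ltsd].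
by apply: pc; rewrite ltcs.
Qed.

Section Labels.

Variables (n : nat) (X : nat -> nat -> bool).

(** Both recursions follow a pipe backwards: [row_pipe] goes left in row [r],
    whose tiles receive the pipes [V] from below, and [rising_pipe] goes down
    through the last [k] rows. *)
Fixpoint row_pipe r (V : nat -> nat) c :=
  if c is c'.+1 then if X r c' then row_pipe r V c' else V c' else r.

Fixpoint rising_pipe k c :=
  if k is k'.+1 then
    let r := n - k in
    if X r c then rising_pipe k' c else row_pipe r (rising_pipe k') c
  else 0.

(** The pipe that leaves tile (r, c) through its top edge; hence
    [top_pipe r.+1 c] is the pipe that enters tile (r, c) from below. *)
Definition top_pipe r c := rising_pipe (n - r) c.

(** The pipe that enters tile (r, c) through its left edge. *)
Definition left_pipe r c := row_pipe r (top_pipe r.+1) c.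

Lemma left_pipe0 r : left_pipe r 0 = r. Proof. by []. Qed.

Lemma left_pipeS r c :
  left_pipe r c.+1 = if X r c then left_pipe r c else top_pipe r.+1 c.
Proof. by []. Qed.

Lemma top_pipeE r c : r < n ->
  top_pipe r c = if X r c then top_pipe r.+1 c else left_pipe r c.
Proof.
move=> ltrn; rewrite /top_pipe /left_pipe /top_pipe.
rewrite -(subnSK ltrn) /= (subnSK ltrn).
by rewrite (subKn (ltnW ltrn)).
Qed.

Lemma top_pipe_n c : top_pipe n c = 0. Proof. by rewrite /top_pipe subnn. Qed.

(** The labels of a modified tiling are found by guessing them and checking the
    recursion. *)
Lemma labels_unique (H U : nat -> nat -> nat) :
    (forall r, H r 0 = r) ->
    (forall r c, r < n -> H r c.+1 = if X r c then H r c else U r.+1 c) ->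
    (forall r c, r < n -> U r c = if X r c then U r.+1 c else H r c) ->
    (forall c, U n c = 0) ->
  (forall r c, r < n -> left_pipe r c = H r c) /\
  (forall r c, r <= n -> top_pipe r c = U r c).
Proof.
move=> H0 HS UE Un.
have step r : r < n -> (forall c, top_pipe r.+1 c = U r.+1 c) ->
    forall c, left_pipe r c = H r c.
  move=> ltrn upr; elim=> [|c IHc]; first by rewrite left_pipe0 H0.
  by rewrite left_pipeS HS // upr IHc.
have upU r : r <= n -> forall c, top_pipe r c = U r c.
  move: r; apply: downward_ind => [c|r ltrn IHr c];
    first by rewrite top_pipe_n Un.
  by rewrite top_pipeE // UE // (step _ ltrn) // IHr.
by split=> r c ler; [apply: step => // x; apply: upU | apply: upU].
Qed.

Definition crossing r c p q :=
  X r c /\ (left_pipe r c = p /\ top_pipe r.+1 c = q \/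
            left_pipe r c = q /\ top_pipe r.+1 c = p).

Definition crossed_from r p q := exists r' c, r <= r' /\ crossing r' c p q.

Lemma crossingC r c p q : crossing r c p q -> crossing r c q p.
Proof. by case=> ? [] []; split=> //; [right | left]. Qed.

Hypothesis stair : forall r c, X r c -> (r + c).+1 < n.

Lemma label_bounds r : r <= n ->
  (forall c, r + c < n -> r <= left_pipe r c < n) /\
  (forall c, r + c < n -> r <= top_pipe r c < n).
Proof.
move: r; apply: downward_ind => [|r ltrn [_ IHr]]; first by split=> c; lia.
have lb c : r + c < n -> r <= left_pipe r c < n.
  elim: c => [|c IHc] ltc; first by rewrite left_pipe0; lia.
  rewrite left_pipeS; case: ifP => Xc; first by apply: IHc; lia.
  by have := IHr c; lia.
split=> // c ltc; rewrite top_pipeE //; case: ifP => Xc; last exact: lb.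
by have := stair Xc; have := IHr c; lia.
Qed.

Lemma left_pipe_bounds r c : r + c < n -> r <= left_pipe r c < n.
Proof. by move=> lt; have [|lb _] := @label_bounds r; [lia | apply: lb]. Qed.

Lemma top_pipe_bounds r c : r + c < n -> r <= top_pipe r c < n.
Proof. by move=> lt; have [|_ lb] := @label_bounds r; [lia | apply: lb]. Qed.

Hypothesis cross_once : forall p q r c r' c', p <> q ->
  crossing r c p q -> crossing r' c' p q -> r = r' /\ c = c'.

(** The pipes met, from left to right, by the cut that runs above the first [c]
    tiles of row [r], down the left edge of tile (r, c), and then below the
    other tiles of that row.  The tiles already swept are those of the lower
    rows and these [c] ones. *)
Definition front r c x :=
  if x < c then top_pipe r x
  else if x == c then left_pipe r c else top_pipe r.+1 x.-1.

Definition crossed_before r c p q :=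
  exists r' c', (r < r' \/ r' = r /\ c' < c) /\ crossing r' c' p q.

(** Two pipes are in their initial order on the cut exactly if they have not
    crossed in the part already swept. *)
Definition front_sorted r c := forall x y, x < y -> y + r < n ->
  front r c x < front r c y /\
    ~ crossed_before r c (front r c x) (front r c y) \/
  front r c y < front r c x /\
    crossed_before r c (front r c x) (front r c y).

Lemma crossed_beforeS r c p q :
  crossed_before r c.+1 p q <-> crossed_before r c p q \/ crossing r c p q.
Proof.
split=> [[r' [c' [lt cr]]] | [[r' [c' [lt cr]]] | cr]].
- case: (r' =P r) lt cr => [->|ne] lt cr; last by left; exists r', c';
    split=> //; lia.
  case: (c' =P c) lt cr => [->|ne] lt cr; first by right.
  by left; exists r, c'; split=> //; right; lia.
- by exists r', c'; split=> //; case: lt; [left | right; lia].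
by exists r, c; split=> //; right; lia.
Qed.

Lemma front_bump r c x : r < n -> ~~ X r c -> front r c.+1 x = front r c x.
Proof.
move=> ltrn nX; rewrite /front; case: (ltngtP x c) => cmp.
- by rewrite ltnS ltnW.
- case: (ltngtP x c.+1) => cmp'; try lia.
  by rewrite cmp' left_pipeS (negbTE nX).
by rewrite cmp ltnSn top_pipeE // (negbTE nX).
Qed.

Lemma front_cross r c x : r < n -> X r c ->
  front r c.+1 x =
  front r c (if x == c then c.+1 else if x == c.+1 then c else x).
Proof.
move=> ltrn Xc; case: (x =P c) => [->|nec].
  by rewrite /front ltnSn top_pipeE // Xc ltnNge leqnSn /= gtn_eqF.
case: (x =P c.+1) => [->|necS]; first by rewrite /front ltnn eqxx ltnn eqxx
  left_pipeS Xc.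
rewrite /front; have -> : (x < c.+1) = (x < c) by lia.
by case: (x < c) => //; case: eqP => // _; case: eqP.
Qed.

(** A bump leaves the cut as it was.  A cross exchanges the neighbours [c] and
    [c.+1]; by [cross_once] they had not crossed before, so the invariant says
    that they were in their initial order, and they are now in the opposite
    one.  The other pairs keep their relative order. *)
Lemma front_sortedS r c : (r + c).+1 < n ->
  front_sorted r c -> front_sorted r c.+1.
Proof.
move=> lt srt; have ltrn : r < n by lia.
case: (boolP (X r c)) => [Xc|nX]; last first.
  move=> x y ltxy lty; rewrite !front_bump //.
  have ncr : ~ crossing r c (front r c x) (front r c y).
    by case=> Xc; rewrite Xc in nX.
  case: (srt x y ltxy lty) => -[? cb]; [left | right]; split=> //.
    by move/crossed_beforeS=> [].
  by apply/crossed_beforeS; left.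
have fc : front r c c = left_pipe r c by rewrite /front ltnn eqxx.
have fcS : front r c c.+1 = top_pipe r.+1 c.
  by rewrite /front ltnNge leqnSn /= gtn_eqF.
have crc : crossing r c (left_pipe r c) (top_pipe r.+1 c) by split=> //; left.
have ltHV : left_pipe r c < top_pipe r.+1 c.
  have [||[]|[lt' [r' [c' [lt2 cr]]]]] := srt c c.+1; rewrite ?fc ?fcS //;
    try lia.
  rewrite fc fcS in lt' cr.
  have ne : left_pipe r c <> top_pipe r.+1 c by lia.
  by have [] := cross_once ne crc cr; lia.
have inj x y : x + r < n -> y + r < n -> front r c x = front r c y -> x = y.
  move=> ltx lty eqf; case: (ltngtP x y) => // cmp.
    by case: (srt x y cmp lty) => -[]; rewrite eqf ltnn.
  by case: (srt y x cmp ltx) => -[]; rewrite eqf ltnn.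
move=> x y ltxy lty; rewrite !front_cross //.
have [[-> ->]|ne] : (x = c /\ y = c.+1) \/ ~ (x = c /\ y = c.+1) by lia.
  rewrite eqxx gtn_eqF // eqxx fc fcS; right; split=> //.
  by apply/crossed_beforeS; right; apply: crossingC.
set x' := if x == c then _ else _; set y' := if y == c then _ else _.
have lt' : x' < y' by rewrite /x' /y'; do ?case: ifP => ?; lia.
have lty' : y' + r < n by rewrite /y'; do ?case: ifP => ?; lia.
have ncr : ~ crossing r c (front r c x') (front r c y').
  rewrite /crossing -fc -fcS => -[_ [] [e1 e2]].
    have := inj _ _ _ _ e1; have := inj _ _ _ _ e2.
    by rewrite /x' /y'; do ?case: ifP => ?; lia.
  by have := inj _ _ _ _ e1; have := inj _ _ _ _ e2; lia.
case: (srt x' y' lt' lty') => -[? cb]; [left | right]; split=> //.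
  by move/crossed_beforeS=> [].
by apply/crossed_beforeS; left.
Qed.

Lemma front_last r x : x + r < n -> front r (n - r.+1) x = top_pipe r x.
Proof.
move=> lt; rewrite /front; case: (ltngtP x (n - r.+1)) => [//||->]; first lia.
rewrite top_pipeE; last lia.
by case: ifP => // /stair; lia.
Qed.

(** A new row only adds, in front of the pipes of the previous row, the pipe
    [r] that enters it: [r] is smaller than all the others and has not met any
    of them. *)
Lemma front_sortedP r c : r + c < n -> front_sorted r c.
Proof.
move=> lt; have lern : r <= n by lia.
move: r lern c lt; apply: downward_ind => [c|m ltmn IHm c]; first by lia.
elim: c => [|c IHc] ltc; last by apply: front_sortedS; [|apply: IHc]; lia.
move=> [|x] [|y] //= ltxy lty; rewrite /front /= ?left_pipe0.
  left; have lby := @top_pipe_bounds m.+1 y; split; first lia.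
  case=> r' [c' [[ltr|[_ //]] [Xc cr]]]; have ltc' := stair Xc.
  have := @left_pipe_bounds r' c'; have := @top_pipe_bounds r'.+1 c'; lia.
have eqb p q : crossed_before m 0 p q <-> crossed_before m.+1 (n - m.+2) p q.
  split=> -[r' [c' [cmp cr]]]; exists r', c'; split=> //.
    by have := stair cr.1; lia.
  by lia.
have [|||[l b]|[l b]] := IHm (n - m.+2) _ x y; rewrite ?front_last //; try lia.
  by rewrite !front_last in l b; try lia; left; split=> // /eqb.
by rewrite !front_last in l b; try lia; right; split=> //; apply/eqb.
Qed.

Lemma crossed_before_last r p q :
  crossed_before r (n - r.+1) p q <-> crossed_from r p q.
Proof.
split=> -[r' [c' [cmp cr]]]; exists r', c'; split=> //; first by lia.
by have := stair cr.1; lia.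
Qed.

Lemma top_pipe_sorted r x y : x < y -> y + r < n ->
  top_pipe r x < top_pipe r y /\
    ~ crossed_from r (top_pipe r x) (top_pipe r y) \/
  top_pipe r y < top_pipe r x /\
    crossed_from r (top_pipe r x) (top_pipe r y).
Proof.
move=> ltxy lty; have lt : r + (n - r.+1) < n by lia.
have := front_sortedP lt ltxy lty; rewrite !front_last; try lia.
case=> -[cmp cb]; first by left; split=> // /crossed_before_last.
by right; split=> //; apply/crossed_before_last.
Qed.

Lemma tile_sorted r c : (r + c).+1 < n ->
  left_pipe r c < top_pipe r.+1 c \/
  top_pipe r.+1 c < left_pipe r c /\
    crossed_before r c (left_pipe r c) (top_pipe r.+1 c).
Proof.
move=> lt; have lt0 : r + c < n by lia.
have ltS : c.+1 + r < n by lia.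
have := front_sortedP lt0 (ltnSn c) ltS.
rewrite /front ltnn eqxx (ltnNge c.+1) leqnSn gtn_eqF //=.
by case=> -[]; [left | right].
Qed.

Lemma tile_neq r c : (r + c).+1 < n -> left_pipe r c <> top_pipe r.+1 c.
Proof. by case/tile_sorted=> [|[]]; lia. Qed.

Lemma cross_lt r c : X r c -> left_pipe r c < top_pipe r.+1 c.
Proof.
move=> Xc; have lt := stair Xc.
case: (tile_sorted lt) => // -[_ [r' [c' [lt2 cr]]]].
have crc : crossing r c (left_pipe r c) (top_pipe r.+1 c) by split=> //; left.
by have [] := cross_once (tile_neq lt) crc cr; lia.
Qed.

Lemma top_pipe_inj r x y : x + r < n -> y + r < n ->
  top_pipe r x = top_pipe r y -> x = y.
Proof.
move=> ltx lty eqf; case: (ltngtP x y) => // cmp.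
  by case: (top_pipe_sorted cmp lty) => -[]; rewrite eqf ltnn.
by case: (top_pipe_sorted cmp ltx) => -[]; rewrite eqf ltnn.
Qed.

(** By counting: [n - r] distinct pipes, all in the range from [r] to [n]. *)
Lemma top_pipe_onto r p : r <= p < n -> exists2 x, x + r < n & top_pipe r x = p.
Proof.
move=> lp; pose s := [seq top_pipe r x | x <- iota 0 (n - r)].
have us : uniq s.
  rewrite map_inj_in_uniq ?iota_uniq // => x y; rewrite !mem_iota => hx hy.
  by apply: top_pipe_inj; lia.
have sub : {subset s <= iota r (n - r)}.
  move=> q /mapP [x]; rewrite !mem_iota => hx ->.
  by have := @top_pipe_bounds r x; lia.
have szs : size (iota r (n - r)) <= size s by rewrite size_map !size_iota.
have [_ eqs] := uniq_min_size us sub szs.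
have : p \in s by rewrite eqs mem_iota; lia.
by case/mapP=> x; rewrite mem_iota => hx ->; exists x; lia.
Qed.

End Labels.

Lemma left_pipe_run n (X : nat -> nat -> bool) r c d :
    (forall s, c <= s < d -> X r s) ->
  forall s, c <= s <= d -> left_pipe n X r s = left_pipe n X r d.
Proof.
move=> run s /andP [lecs lesd]; move: s lesd lecs.
apply: downward_ind => // s ltsd IHs lecs.
by rewrite -IHs ?left_pipeS ?run //; lia.
Qed.

(** * Moving two pipes around a rectangle *)

(** A chute rectangle in terms of labels: pipe [i] goes up column [c] and then
    right along row [a], pipe [j] goes right along row [b] and then up column
    [d]. *)
Record chute_box n (X : nat -> nat -> bool) (i j a b c d : nat) : Prop := {
  box_rows : a < b < n;
  box_cols : c < d;
  box_top_left : ~~ X a c;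
  box_bottom_left : ~~ X b c;
  box_bottom_right : ~~ X b d;
  box_crosses : forall r s, a <= r <= b -> c <= s <= d ->
    ~ (r = a /\ s = c) -> ~ (r = b /\ s = c) -> ~ (r = b /\ s = d) -> X r s;
  box_left_pipe : left_pipe n X b c = i;
  box_right_pipe : top_pipe n X b.+1 c = j }.

(** Exchange of opposite sides of the rectangle: the left and right sides row by
    row, the top and bottom sides column by column, and the corners (b, c) and
    (a, d). *)
Definition mirror (a b c d : nat) (x : nat * nat) :=
  let: (r, s) := x in
  if (a < r < b) && ((s == c) || (s == d)) then (r, if s == c then d else c)
  else if (c < s < d) && ((r == a) || (r == b)) then
    (if r == a then b else a, s)
  else if (r == b) && (s == c) then (a, d)
  else if (r == a) && (s == d) then (b, c)
  else x.

Lemma mirrorK a b c d : a < b -> c < d -> involutive (mirror a b c d).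
Proof.
move=> ltab ltcd [r s]; rewrite /mirror.
by case: (s =P c) => ?; case: (r =P a) => ? /=; do ?[case: ifP => ? /=];
  congr pair; lia.
Qed.

Section Chute.

Variables (n : nat) (X : nat -> nat -> bool) (i j a b c d : nat).
Notation top_pipe := (top_pipe n). Notation left_pipe := (left_pipe n).
Hypothesis box : chute_box n X i j a b c d.

Let ltab : a < b. Proof. by case/andP: (box_rows box). Qed.
Let ltbn : b < n. Proof. by case/andP: (box_rows box). Qed.
Let ltcd : c < d := box_cols box.
Let Xac := box_top_left box.
Let Xbc := box_bottom_left box.
Let Xbd := box_bottom_right box.
Let Xrect := box_crosses box.
Let lbc := box_left_pipe box.
Let ubc := box_right_pipe box.

Lemma top_pipe_column s r : c <= s <= d -> a < r <= b ->
  top_pipe X r s = top_pipe X b s.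
Proof.
move=> hs /andP [ltar lerb].
move: r lerb ltar; apply: downward_ind => // r ltrb IHr ltar.
have ltrn : r < n by lia.
have Xrs : X r s by apply: Xrect; lia.
by rewrite top_pipeE // Xrs IHr; lia.
Qed.

Lemma top_pipe_left r : a < r <= b -> top_pipe X r c = i.
Proof.
have lecd : c <= c <= d by lia.
by move=> hr; rewrite top_pipe_column // top_pipeE // (negbTE Xbc).
Qed.

Lemma left_pipe_bottom s : c < s <= d -> left_pipe X b s = j.
Proof.
elim: s => // s IHs hs; rewrite left_pipeS.
case: (ltngtP s c) => [|ltcs|->]; first by lia.
  have -> : X b s by apply: Xrect; lia.
  by apply: IHs; lia.
by rewrite (negbTE Xbc).
Qed.

Lemma top_pipe_right r : a < r <= b -> top_pipe X r d = j.
Proof.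
have ledd : c <= d <= d by lia.
move=> hr; rewrite top_pipe_column // top_pipeE // (negbTE Xbd)
  left_pipe_bottom //; lia.
Qed.

Lemma left_pipe_top s : c < s <= d -> left_pipe X a s = i.
Proof.
elim: s => // s IHs hs; rewrite left_pipeS.
case: (ltngtP s c) => [|ltcs|->]; first by lia.
  have -> : X a s by apply: Xrect; lia.
  by apply: IHs; lia.
by rewrite (negbTE Xac) top_pipe_left; lia.
Qed.

(** [X'] is the tiling after the chute move. *)
Variable X' : nat -> nat -> bool.
Hypothesis X'E : forall r s, X' r s =
  if (r == b) && (s == c) then true
  else if (r == a) && (s == d) then false else X r s.

(** The labels after the move: [i] and [j] have exchanged their routes. *)
Definition top_pipe_chute r s :=
  if (a < r <= b) && (s == c) then j
  else if (a < r <= b) && (s == d) then i else top_pipe X r s.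

Definition left_pipe_chute r s :=
  if (c < s <= d) && (r == b) then i
  else if (c < s <= d) && (r == a) then j else left_pipe X r s.

Lemma left_pipe_chute_bottom s : c < s <= d -> left_pipe_chute b s = i.
Proof. by move=> hs; rewrite /left_pipe_chute hs eqxx. Qed.

Lemma left_pipe_chute_top s : c < s <= d -> left_pipe_chute a s = j.
Proof. by move=> hs; rewrite /left_pipe_chute hs eqxx ltn_eqF. Qed.

Lemma left_pipe_chute_out r s : ~ (c < s <= d /\ (r = a \/ r = b)) ->
  left_pipe_chute r s = left_pipe X r s.
Proof.
by move=> out; rewrite /left_pipe_chute; do 2![case: ifP => [?|_]; first lia].
Qed.

Lemma top_pipe_chute_left r : a < r <= b -> top_pipe_chute r c = j.
Proof. by move=> hr; rewrite /top_pipe_chute hr eqxx. Qed.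

Lemma top_pipe_chute_right r : a < r <= b -> top_pipe_chute r d = i.
Proof. by move=> hr; rewrite /top_pipe_chute hr eqxx gtn_eqF. Qed.

Lemma top_pipe_chute_out r s : ~ (a < r <= b /\ (s = c \/ s = d)) ->
  top_pipe_chute r s = top_pipe X r s.
Proof.
by move=> out; rewrite /top_pipe_chute; do 2![case: ifP => [?|_]; first lia].
Qed.

Lemma chute_new_cross : X' b c. Proof. by rewrite X'E !eqxx. Qed.

Lemma chute_old_cross : X' a d = false.
Proof. by rewrite X'E !eqxx (ltn_eqF ltab). Qed.

Lemma chute_other_tile r s : ~ (r = b /\ s = c) -> ~ (r = a /\ s = d) ->
  X' r s = X r s.
Proof. by move=> h1 h2; rewrite X'E; do 2![case: ifP => [?|_]; first lia]. Qed.

Lemma box_top_right : X a d. Proof. by apply: Xrect; lia. Qed.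

Lemma left_pipe_chuteS r s : r < n ->
  left_pipe_chute r s.+1 =
    if X' r s then left_pipe_chute r s else top_pipe_chute r.+1 s.
Proof.
move=> ltrn; case: (r =P b) => [->|nb]; last case: (r =P a) => [->|na].
- have [->|[->|[hs|hs]]] : s = c \/ s = d \/ c < s < d \/ (s < c \/ d < s) by
    lia.
  + by rewrite chute_new_cross left_pipe_chute_bottom ?left_pipe_chute_out //;
      lia.
  + rewrite chute_other_tile ?(negbTE Xbd) ?left_pipe_chute_out
      ?top_pipe_chute_out ?left_pipeS ?(negbTE Xbd) //; lia.
  + have Xbs : X b s by apply: Xrect; lia.
    by rewrite chute_other_tile ?Xbs ?left_pipe_chute_bottom //; lia.
  by rewrite chute_other_tile ?(@left_pipe_chute_out b) ?top_pipe_chute_out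
    ?left_pipeS //; lia.
- have [->|[->|[hs|hs]]] : s = c \/ s = d \/ c < s < d \/ (s < c \/ d < s) by
    lia.
  + by rewrite chute_other_tile ?(negbTE Xac) ?left_pipe_chute_top
      ?top_pipe_chute_left //; lia.
  + by rewrite chute_old_cross left_pipe_chute_out ?top_pipe_chute_right
      ?left_pipeS ?box_top_right ?left_pipe_top //; lia.
  + have Xas : X a s by apply: Xrect; lia.
    by rewrite chute_other_tile ?Xas ?left_pipe_chute_top //; lia.
  by rewrite chute_other_tile ?(@left_pipe_chute_out a) ?top_pipe_chute_out
    ?left_pipeS //; lia.
rewrite chute_other_tile ?(@left_pipe_chute_out r) ?left_pipeS; try lia.
case: ifP => // nX; rewrite top_pipe_chute_out // => -[hr hs].
by have h : X r s by [apply: Xrect; lia]; rewrite h in nX.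
Qed.

Lemma top_pipe_chuteE r s : r < n ->
  top_pipe_chute r s =
    if X' r s then top_pipe_chute r.+1 s else left_pipe_chute r s.
Proof.
move=> ltrn; case: (s =P c) => [->|nc]; last case: (s =P d) => [->|nd].
- have [->|[->|[hr|hr]]] : r = b \/ r = a \/ a < r < b \/ (r < a \/ b < r) by
    lia.
  + by rewrite chute_new_cross top_pipe_chute_left ?top_pipe_chute_out //; lia.
  + by rewrite chute_other_tile ?(negbTE Xac) ?top_pipe_chute_out
      ?left_pipe_chute_out 1?top_pipeE ?(negbTE Xac) //; lia.
  + have Xrc : X r c by apply: Xrect; lia.
    by rewrite chute_other_tile ?Xrc ?top_pipe_chute_left //; lia.
  by rewrite chute_other_tile ?top_pipe_chute_out ?left_pipe_chute_out
    1?top_pipeE //; lia.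
- have [->|[->|[hr|hr]]] : r = b \/ r = a \/ a < r < b \/ (r < a \/ b < r) by
    lia.
  + by rewrite chute_other_tile ?(negbTE Xbd) ?top_pipe_chute_right
      ?left_pipe_chute_bottom //; lia.
  + by rewrite chute_old_cross top_pipe_chute_out 1?top_pipeE ?box_top_right
      ?left_pipe_chute_top ?top_pipe_right //; lia.
  + have Xrd : X r d by apply: Xrect; lia.
    by rewrite chute_other_tile ?Xrd ?top_pipe_chute_right //; lia.
  by rewrite chute_other_tile ?top_pipe_chute_out ?left_pipe_chute_out
    1?top_pipeE //; lia.
rewrite chute_other_tile ?(@top_pipe_chute_out _ s) 1?top_pipeE; try lia.
case: ifP => // nX; rewrite left_pipe_chute_out // => -[hr hs].
by have h : X r s by [apply: Xrect; lia]; rewrite h in nX.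
Qed.

(** The expected labels satisfy the recursion that defines the labels. *)
Lemma labels_chute :
  (forall r s, r < n -> left_pipe X' r s = left_pipe_chute r s) /\
  (forall r s, r <= n -> top_pipe X' r s = top_pipe_chute r s).
Proof.
apply: labels_unique => [r|r s|r s|s].
- by rewrite /left_pipe_chute ltn0.
- exact: left_pipe_chuteS.
- exact: top_pipe_chuteE.
by rewrite top_pipe_chute_out ?top_pipe_n //; lia.
Qed.

(** A pipe that traverses the rectangle straight crosses both [i] and [j], on
    opposite sides; exchanging [i] with [j] on both sides is the same as
    exchanging the two sides. *)
Lemma crossing_mirror r s p q : r < n ->
  crossing n X' r s p q <->
  crossing n X (mirror a b c d (r, s)).1 (mirror a b c d (r, s)).2 p q.
Proof.
have [lftE upE'] := labels_chute.
move=> ltrn; rewrite /crossing lftE // upE' // /mirror.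
have row_run s' : a < r < b -> c <= s' <= d ->
  left_pipe X r s' = left_pipe X r d.
  by move=> hr; apply: left_pipe_run => t ht; apply: Xrect; lia.
case: ifP => [/andP [hr /orP [] /eqP ->]|nside].
- have Xrc : X r c by apply: Xrect; lia.
  have Xrd : X r d by apply: Xrect; lia.
  rewrite eqxx /= chute_other_tile ?Xrc ?Xrd ?left_pipe_chute_out
    ?top_pipe_chute_left ?top_pipe_right ?(row_run c) //; lia.
- have Xrc : X r c by apply: Xrect; lia.
  have Xrd : X r d by apply: Xrect; lia.
  rewrite gtn_eqF //= chute_other_tile ?Xrc ?Xrd ?left_pipe_chute_out
    ?top_pipe_chute_right ?top_pipe_left ?(row_run c) //; lia.
case: ifP => [/andP [hs /orP [] /eqP ->]|nends].
- have Xas : X a s by apply: Xrect; lia.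
  have Xbs : X b s by apply: Xrect; lia.
  have upab : top_pipe X a.+1 s = top_pipe X b.+1 s.
    by rewrite (@top_pipe_column s a.+1) 1?top_pipeE ?Xbs; lia.
  rewrite eqxx /= chute_other_tile ?Xas ?Xbs ?left_pipe_chute_top
    ?top_pipe_chute_out ?left_pipe_bottom ?upab //; lia.
- have Xas : X a s by apply: Xrect; lia.
  have Xbs : X b s by apply: Xrect; lia.
  have upab : top_pipe X a.+1 s = top_pipe X b.+1 s.
    by rewrite (@top_pipe_column s a.+1) 1?top_pipeE ?Xbs; lia.
  rewrite gtn_eqF //= chute_other_tile ?Xas ?Xbs ?left_pipe_chute_bottom
    ?top_pipe_chute_out ?left_pipe_top ?upab //; lia.
case: ifP => [/andP [/eqP -> /eqP ->]|nbc] /=.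
  rewrite chute_new_cross box_top_right left_pipe_chute_out ?top_pipe_chute_out
    ?left_pipe_top ?top_pipe_right ?lbc ?ubc //; lia.
case: ifP => [/andP [/eqP -> /eqP ->]|nad] /=.
  by rewrite chute_old_cross (negbTE Xbc); split=> -[].
rewrite chute_other_tile; try lia.
have [Xrs|nX] := boolP (X r s); last by split=> -[].
have ne1 : ~ (r = a /\ s = c) by case=> e1 e2;
  rewrite e1 e2 (negbTE Xac) in Xrs.
have ne2 : ~ (r = b /\ s = d) by case=> e1 e2;
  rewrite e1 e2 (negbTE Xbd) in Xrs.
by rewrite left_pipe_chute_out ?top_pipe_chute_out //; lia.
Qed.

End Chute.

(** * Pipe dreams as tilings *)

(** A tiling on all pairs of natural numbers, for the recursions above. *)
Definition crosses n (P : pipedream n) r c :=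
  [exists x in P, (x.1 == r :> nat) && (x.2 == c :> nat)].

Lemma crossesE n (P : pipedream n) (r c : 'I_n) :
  crosses P r c = ((r, c) \in P).
Proof.
apply/exists_inP/idP => [[[r' c'] inP /= /andP [/eqP er /eqP ec]]|inP].
  by rewrite (val_inj er) (val_inj ec) in inP.
by exists (r, c); rewrite ?eqxx.
Qed.

Lemma crosses_ord n (P : pipedream n) r c : crosses P r c ->
  exists r' c' : 'I_n, [/\ r = r', c = c' & (r', c') \in P].
Proof.
case/exists_inP=> -[r' c'] inP /= /andP [/eqP er /eqP ec].
by exists r', c'.
Qed.

Lemma crosses_inj n (P Q : pipedream n) : crosses P =2 crosses Q -> P = Q.
Proof. by move=> eqX; apply/setP => -[r c]; rewrite -!crossesE eqX. Qed.

Section Entries.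

Variables (n : nat) (P : pipedream n).
Notation X := (crosses P).
Notation top_pipe := (top_pipe n X). Notation left_pipe := (left_pipe n X).

Definition entry_pipe (s : entry n) : nat :=
  let: (from_left, (r, c)) := s in
  if from_left then left_pipe r c else top_pipe r.+1 c.

Lemma next_entry_pipe s t : next_entry P s t -> entry_pipe s = entry_pipe t.
Proof.
case: s t => [l [r c]] [l' [r' c']]; rewrite /next_entry /exits_up /=.
rewrite -crossesE; case: ifP => hX /and3P [hl /eqP hr /eqP hc].
  rewrite (negbTE hl) hc -hr [in RHS]top_pipeE //.
  by move: hX; case: l; case: (X r c).
rewrite hl hc left_pipeS hr.
by move: hX; case: l; case: (X r c).
Qed.

Lemma pipe_enters_pipe p s : pipe_enters P p s -> entry_pipe s = p.
Proof.
case/connectP=> t path_t ->.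
suff <- : entry_pipe (true, (p, first_col p)) =
          entry_pipe (last (true, (p, first_col p)) t) by [].
elim: t {p s}(true, (p, first_col p)) path_t => [|t ts IHt] s //=.
by case/andP=> /next_entry_pipe -> /IHt.
Qed.

Hypothesis stair : forall r c, (r, c) \in P -> (r + c).+1 < n.

Lemma crosses_stair r c : X r c -> (r + c).+1 < n.
Proof. by case/crosses_ord=> r' [c' [-> -> /stair]]. Qed.

(** Every edge inside the staircase is reached: going backwards from it, [c]
    decreases or [r] increases until the left edge of the grid.  Outside the
    staircase the labels carry no information. *)
Lemma pipe_enters_complete (p : 'I_n) (l : bool) (r c : 'I_n) :
    (if l then r + c < n else (r + c).+1 < n) ->
  entry_pipe (l, (r, c)) = p -> pipe_enters P p (l, (r, c)).
Proof.
have [m] := ubnP ((n - r) + c).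
elim: m => // m IHm in l r c * => ltm lt.
case: l lt ltm => lt ltm /=.
  case: c => [[|c] ltc] /= in lt ltm *.
    rewrite left_pipe0 => /val_inj ->; rewrite /pipe_enters.
    by have -> : first_col p = Ordinal ltc by apply: val_inj.
  have ltc' : c < n by lia.
  pose c' := Ordinal ltc'.
  rewrite left_pipeS -[c]/(val c'); case: ifP => Xc e.
    have : pipe_enters P p (true, (r, c')) by apply: IHm => //=; lia.
    move/connect_trans; apply; apply: connect1.
    by rewrite /next_entry /exits_up /= -crossesE Xc !eqxx.
  have : pipe_enters P p (false, (r, c')) by apply: IHm => //=; lia.
  move/connect_trans; apply; apply: connect1.
  by rewrite /next_entry /exits_up /= -crossesE Xc !eqxx.
have ltr' : r.+1 < n by lia.
pose r' := Ordinal ltr'.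
rewrite -[r.+1]/(val r') (top_pipeE _ _ (ltn_ord r')); case: ifP => Xc e.
  have lt' := crosses_stair Xc.
  have : pipe_enters P p (false, (r', c)) by apply: IHm => //=; lia.
  move/connect_trans; apply; apply: connect1.
  by rewrite /next_entry /exits_up /= -crossesE Xc !eqxx.
have : pipe_enters P p (true, (r', c)) by apply: IHm => //=; lia.
move/connect_trans; apply; apply: connect1.
by rewrite /next_entry /exits_up /= -crossesE Xc !eqxx.
Qed.

Lemma pipe_entersE (p : 'I_n) (l : bool) (r c : 'I_n) :
    (if l then r + c < n else (r + c).+1 < n) ->
  pipe_enters P p (l, (r, c)) <-> entry_pipe (l, (r, c)) = p.
Proof.
by move=> lt; split; [apply: pipe_enters_pipe | apply: pipe_enters_complete].
Qed.

Lemma pipes_crossE (p q r c : 'I_n) :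
  pipes_cross P p q (r, c) <-> crossing n X r c p q.
Proof.
rewrite /pipes_cross /crossing crossesE.
have [inP|ninP] := boolP ((r, c) \in P); last by split=> -[].
have lt := stair inP.
have enters (s : 'I_n) l : pipe_enters P s (l, (r, c)) <->
    (if l then left_pipe r c else top_pipe r.+1 c) = s.
  by apply: pipe_entersE; case: l; lia.
have h1 := enters p true; have h2 := enters q true.
have h3 := enters p false; have h4 := enters q false.
split=> [/orP [] /andP [e1 e2]|[_ [] [e1 e2]]].
- by split=> //; left; rewrite -(iffLR h1) // -(iffLR h4).
- by split=> //; right; rewrite -(iffLR h2) // -(iffLR h3).
- by apply/orP; left; apply/andP; split; [apply/h1 | apply/h4].
by apply/orP; right; apply/andP; split; [apply/h3 | apply/h2].
Qed.

Lemma pipe_exits_topE (p c : 'I_n) : pipe_exits_top P p c <-> top_pipe 0 c = p.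
Proof.
have n0 : 0 < n by apply: leq_ltn_trans (ltn_ord p).
pose r0 := Ordinal n0; split=> [[[l [r c']]]|e].
  rewrite /exits_up /= -crossesE => -[ent r0E ec ex].
  rewrite {}ec in ent ex.
  rewrite -r0E (top_pipeE _ _ (ltn_ord r)) -(pipe_enters_pipe ent) /=.
  by case: l ex {ent}; case: (X r c).
have ltX : X r0 c -> (r0 + c).+1 < n by move/crosses_stair.
exists (~~ X r0 c, (r0, c)); split=> //; last first.
  by rewrite /exits_up /= -crossesE; case: (X _ _).
apply: pipe_enters_complete; first by case: (X r0 c) ltX => [/(_ isT)|_] /=;
  have := ltn_ord c; lia.
by rewrite -e (top_pipeE _ _ (ltn_ord r0)) /= if_neg.
Qed.

(** Labels of crosses are smaller than [n], so no generality is lost by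
    quantifying over ordinals in [pd_reduced]. *)
Lemma reduced_pipedreamE (w : 'S_n) : reduced_pipedream w P <->
  (forall p : 'I_n, top_pipe 0 (w p) = p) /\
  (forall p q r c r' c', p <> q ->
    crossing n X r c p q -> crossing n X r' c' p q -> r = r' /\ c = c').
Proof.
split=> [hP|[ex once]]; split=> //.
- by move=> p; apply/pipe_exits_topE/(pd_exits hP).
- move=> p q r c r' c' ne cr cr'.
  have ltx := crosses_stair cr.1.
  have [ltp ltq] : p < n /\ q < n.
    have := @left_pipe_bounds n X crosses_stair r c;
      have := @top_pipe_bounds n X crosses_stair r.+1 c.
    by case: cr => _; lia.
  have [r1 [c1 [er ec _]]] := crosses_ord cr.1.
  have [r2 [c2 [er' ec' _]]] := crosses_ord cr'.1; subst r c r' c'.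
  have ne' : Ordinal ltp != Ordinal ltq by apply/eqP=> -[].
  have : (r1, c1) = (r2, c2).
    by apply: (pd_reduced hP ne'); apply/pipes_crossE.
  by case=> -> ->.
- by move=> p; apply/pipe_exits_topE.
move=> p q [r c] [r' c'] ne /pipes_crossE cr /pipes_crossE cr'.
have ne' : nat_of_ord p <> nat_of_ord q by move/val_inj; apply/eqP.
by have [/val_inj -> /val_inj ->] := once _ _ _ _ _ _ ne' cr cr'.
Qed.

End Entries.

(** * The tableau of a pipe dream *)

Section Phi.

Variables (n : nat) (w : 'S_n) (P : pipedream n).
Hypothesis hP : reduced_pipedream w P.
Notation X := (crosses P).
Notation top_pipe := (top_pipe n X). Notation left_pipe := (left_pipe n X).
Notation T := (phi w P).

Let stair : forall r c, X r c -> (r + c).+1 < n :=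
  crosses_stair (pd_staircase hP).
Let exits : forall p : 'I_n, top_pipe 0 (w p) = p :=
  proj1 (iffLR (reduced_pipedreamE (pd_staircase hP) w) hP).
Let once : forall p q r c r' c', p <> q ->
    crossing n X r c p q -> crossing n X r' c' p q -> r = r' /\ c = c' :=
  proj2 (iffLR (reduced_pipedreamE (pd_staircase hP) w) hP).

Lemma inversion_crossed (p q : 'I_n) : p < q ->
  is_inversion w p q <-> crossed_from n X 0 p q.
Proof.
move=> ltpq; rewrite /is_inversion ltpq /=.
have ltw (s : 'I_n) : w s + 0 < n by rewrite addn0.
case: (ltngtP (w q) (w p)) => [lt|lt|/val_inj/perm_inj eqpq].
- have := top_pipe_sorted stair once lt (ltw p); rewrite !exits => -[[]|[_ cr]];
    first lia.
  split=> // _; case: cr => r [c [h /crossingC cr]]; by exists r, c.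
- by have := top_pipe_sorted stair once lt (ltw q); rewrite !exits => -[[]|[]];
    [split | lia].
by rewrite eqpq ltnn in ltpq.
Qed.

Lemma phi_crossing (p q : 'I_n) r c : p < q -> crossing n X r c p q ->
  T p q = r.+1.
Proof.
move=> ltpq cr; rewrite mxE /phi_entry (iffRL (inversion_crossed ltpq));
  last by exists r, c.
have [r1 [c1 [er ec _]]] := crosses_ord cr.1; subst r c.
have ne : nat_of_ord p <> q by lia.
case: pickP => [[r' c'] /(pipes_crossE (pd_staircase hP)) cr'|/(_ (r1, c1))].
  by have [<-] := once ne cr cr'.
by rewrite (iffRL (pipes_crossE (pd_staircase hP) _ _ _ _)).
Qed.

Lemma crossing_lt p q r c : p < q -> crossing n X r c p q ->
  left_pipe r c = p /\ top_pipe r.+1 c = q.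
Proof. by move=> ltpq [Xrc]; have := cross_lt stair once Xrc; lia. Qed.

Lemma phi_row (p q : 'I_n) r : T p q = r.+1 ->
  p < q /\ exists c, [/\ X r c, left_pipe r c = p & top_pipe r.+1 c = q].
Proof.
move=> Tpq.
have inv : is_inversion w p q.
  by move: Tpq; rewrite mxE /phi_entry; case: ifP.
have ltpq : p < q by case/andP: inv.
have [r' [c [_ cr]]] := iffLR (inversion_crossed ltpq) inv.
have [<-] : r'.+1 = r.+1 by rewrite -(phi_crossing ltpq cr).
by split=> //; exists c; have [] := crossing_lt ltpq cr; split=> //; case: cr.
Qed.

Lemma phi_crossed_from (p q : 'I_n) r : p < q ->
  r < T p q <-> crossed_from n X r p q.
Proof.
move=> ltpq; split=> [ltT|[r' [c [ler cr]]]];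
  last by rewrite (phi_crossing ltpq cr).
have [_ [c [Xc e1 e2]]] : p < q /\ exists c,
    [/\ X (T p q).-1 c, left_pipe (T p q).-1 c = p
                      & top_pipe (T p q).-1.+1 c = q].
  by apply: phi_row; lia.
by exists (T p q).-1, c; split; [lia | split; [|left]].
Qed.

Lemma phi_order r x y (p q : 'I_n) : p < q -> x + r < n -> y + r < n ->
  top_pipe r x = p -> top_pipe r y = q -> (x < y) = (T p q <= r).
Proof.
move=> ltpq ltx lty ex ey; rewrite [RHS]leqNgt.
case: (ltngtP x y) => [lt|lt|eqxy].
- have := top_pipe_sorted stair once lt lty; rewrite ex ey => -[[_ ncr]|[]];
    last lia.
  by symmetry; apply/negP => /(phi_crossed_from r ltpq).
- have := top_pipe_sorted stair once lt ltx; rewrite ex ey => -[[]|[_ cr]];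
    first lia.
  symmetry; apply/negbTE; rewrite negbK; apply/(phi_crossed_from r ltpq).
  by case: cr => r' [c [h /crossingC cr]]; exists r', c.
by rewrite -ey -ex eqxy ltnn in ltpq.
Qed.

Lemma phi_row_bound (p q : 'I_n) : T p q <= p.+1.
Proof.
case ET: (T p q) => [//|r]; have [_ [c [Xc <- _]]] := phi_row ET.
by have := @left_pipe_bounds n X stair r c; have := stair Xc; lia.
Qed.

(** Along the top of a row [r] with [r <= i] the three pipes are all present,
    and [T p q <= r] says that p is to the left of q; so the claim is
    transitivity of the relations to the left of and to the right of, for the
    row [r] at which it would fail. *)
Lemma phi_triple : triple_median T.
Proof.
move=> i k j /andP [ltik ltkj]; have ltij := ltn_trans ltik ltkj.
have order r : r <= i -> (T i k <= r -> T k j <= r -> T i j <= r) /\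
                         (r < T i k -> r < T k j -> r < T i j).
  move=> leri; have ltin := ltn_ord j.
  have [|x ltx ex] := @top_pipe_onto n X stair once r i; try lia.
  have [|y lty ey] := @top_pipe_onto n X stair once r k; try lia.
  have [|z ltz ez] := @top_pipe_onto n X stair once r j; try lia.
  have := phi_order ltik ltx lty ex ey; have := phi_order ltkj lty ltz ey ez.
  have := phi_order ltij ltx ltz ex ez; lia.
have := phi_row_bound i j; have := phi_row_bound i k; have := phi_row_bound k j.
have := order (maxn (T i k) (T k j)); have := order (T i j).
by rewrite /between; lia.
Qed.

Lemma phi_tableau : inversions_tableau w T.
Proof.
split=> [p q ninv|p q inv|||].
- by rewrite mxE /phi_entry (negbTE ninv).
- have ltpq : p < q by case/andP: inv.
  have [r [c [_ cr]]] := iffLR (inversion_crossed ltpq) inv.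
  by rewrite (phi_crossing ltpq cr); have := stair cr.1; lia.
- exact: triple_hook_median phi_triple.
- move=> p p' q inv inv' ne; apply/eqP => eqT.
  have ltpq : p < q by case/andP: inv.
  have [r [c [_ cr]]] := iffLR (inversion_crossed ltpq) inv.
  have eT := phi_crossing ltpq cr.
  have [_ [x [Xx ex fx]]] := phi_row eT.
  have [_ [y [Xy ey fy]]] := phi_row (etrans (esym eqT) eT).
  have eqxy : x = y.
    apply: (top_pipe_inj stair once (r := r.+1)); rewrite ?fx ?fy //.
      by have := stair Xx; lia.
    by have := stair Xy; lia.
  by case/eqP: ne; apply: val_inj; rewrite /= -ex -ey eqxy.
by move=> p q _; apply: phi_row_bound.
Qed.

End Phi.

Section Injective.

Variables (n : nat) (w : 'S_n) (P Q : pipedream n).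
Hypotheses (hP : reduced_pipedream w P) (hQ : reduced_pipedream w Q).
Hypothesis eq_phi : phi w P = phi w Q.

Let stairP := crosses_stair (pd_staircase hP).
Let stairQ := crosses_stair (pd_staircase hQ).
Let onceP := proj2 (iffLR (reduced_pipedreamE (pd_staircase hP) w) hP).
Let onceQ := proj2 (iffLR (reduced_pipedreamE (pd_staircase hQ) w) hQ).

(** Both sequences list the pipes from [r] on in the same order.  At the first
    difference, the two pipes would be in opposite orders. *)
Lemma phi_eq_top_pipe r x : x + r < n ->
  top_pipe n (crosses Q) r x = top_pipe n (crosses P) r x.
Proof.
have [m] := ubnP x; elim: m => // m IHm in x * => ltm ltx.
have bP := @top_pipe_bounds n _ stairP r x;
  have bQ := @top_pipe_bounds n _ stairQ r x.
have [|y lty ey] := top_pipe_onto stairQ onceQ (p := top_pipe n (crosses P) r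
  x) (r := r); try lia.
have [|z ltz ez] := top_pipe_onto stairP onceP (p := top_pipe n (crosses Q) r
  x) (r := r); try lia.
case: (ltngtP y x) => [ltyx|ltxy|eyx]; last by rewrite -ey eyx.
  have := IHm y _ lty; rewrite ey => eP.
  have e : x = y by apply: (top_pipe_inj stairP onceP ltx lty); apply: eP; lia.
  by lia.
case: (ltngtP z x) => [ltzx|ltxz|ezx]; last by rewrite -ez ezx.
  have := IHm z _ ltz; rewrite ez => eQ.
  have e : z = x by apply: (top_pipe_inj stairQ onceQ ltz ltx); apply: eQ; lia.
  by lia.
have ltp : top_pipe n (crosses P) r x < n by lia.
have ltq : top_pipe n (crosses Q) r x < n by lia.
pose p := Ordinal ltp; pose q := Ordinal ltq.
case: (ltngtP p q) => [lt|lt|/esym //].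
  have := phi_order hP lt ltx ltz erefl ez.
  by have := phi_order hQ lt lty ltx ey erefl; rewrite eq_phi; lia.
have := phi_order hP lt ltz ltx ez erefl.
by have := phi_order hQ lt ltx lty erefl ey; rewrite eq_phi; lia.
Qed.

(** At a bump or an elbow the pipe from the left leaves through the top, and it
    differs from the pipe that comes from below. *)
Lemma phi_inj : P = Q.
Proof.
apply: crosses_inj => r c.
have [lt|ge] := ltnP (r + c).+1 n; last first.
  have nX (S : pipedream n) : reduced_pipedream w S -> crosses S r c = false.
    move=> hS; case E: (crosses S r c) => //.
    by have := crosses_stair (pd_staircase hS) E; lia.
  by rewrite !nX.
have XE (S : pipedream n) : reduced_pipedream w S ->
    crosses S r c = (top_pipe n (crosses S) r c == top_pipe n (crosses S) r.+1
      c).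
  move=> hS; rewrite [in RHS]top_pipeE; last lia.
  have := tile_neq (crosses_stair (pd_staircase hS))
    (proj2 (iffLR (reduced_pipedreamE (pd_staircase hS) w) hS)) lt.
  by case: (crosses S r c); rewrite ?eqxx // => /eqP/negbTE ->.
by rewrite !XE // !phi_eq_top_pipe //; lia.
Qed.

End Injective.

(** * Chute moves on pipe dreams *)

Section PipedreamChute.

Variables (n : nat) (w : 'S_n) (P : pipedream n) (i j a b c d : 'I_n).
Notation X := (crosses P).

Lemma chute_rectangle_box :
  chute_rectangle P i j a b c d -> chute_box n X i j a b c d.
Proof.
case=> [[ltab ltcd] [/andP [ac _] /andP [bc _]] bd rect [ei ej]].
split=> //; rewrite ?crossesE //.
- by rewrite ltab ltn_ord.
- by case/orP: bd => /andP [].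
- move=> r s hr hs n1 n2 n3; have ltr : r < n by have := ltn_ord b; lia.
  have lts : s < n by have := ltn_ord d; lia.
  rewrite (crossesE P (Ordinal ltr) (Ordinal lts)); apply: rect => //.
  by rewrite !inE !xpair_eqE -!val_eqE /=; lia.
- exact: pipe_enters_pipe ei.
exact: pipe_enters_pipe ej.
Qed.

Lemma crosses_chute r s : crosses ((b, c) |: (P :\ (a, d))) r s =
  if (r == b) && (s == c) then true
  else if (r == a) && (s == d) then false else X r s.
Proof.
have bnd (S : pipedream n) : ~~ ((r < n) && (s < n)) -> crosses S r s = false.
  move=> out; case E: (crosses S r s) => //;
    have [r' [s' [er es _]]] := crosses_ord E.
  by rewrite er es !ltn_ord in out.
have [/andP [ltr lts]|out] := boolP ((r < n) && (s < n)).
  rewrite (crossesE P (Ordinal ltr) (Ordinal lts)) (crossesE _ (Ordinal ltr)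
    (Ordinal lts)).
  by rewrite !inE !xpair_eqE -!val_eqE /=; do 2?case: ifP.
rewrite !bnd //; have := ltn_ord b; have := ltn_ord c => ltb ltc.
by do 2?[case: ifP => ?] => //; lia.
Qed.

Hypothesis hP : reduced_pipedream w P.
Hypothesis rect : chute_rectangle P i j a b c d.

Let P' : pipedream n := (b, c) |: (P :\ (a, d)).
Notation X' := (crosses P').

Let stair := crosses_stair (pd_staircase hP).
Let exits := proj1 (iffLR (reduced_pipedreamE (pd_staircase hP) w) hP).
Let once := proj2 (iffLR (reduced_pipedreamE (pd_staircase hP) w) hP).
Let box := chute_rectangle_box rect.
Let ltab : a < b. Proof. by case: rect => -[]. Qed.
Let ltcd : c < d. Proof. by case: rect => -[]. Qed.

Let mirrored r s p q : r < n -> crossing n X' r s p q <->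
  crossing n X (mirror a b c d (r, s)).1 (mirror a b c d (r, s)).2 p q :=
  crossing_mirror box crosses_chute s p q (r:=r).

Let stair' : forall r s, (r, s) \in P' -> (r + s).+1 < n.
Proof.
move=> r s; rewrite !inE => /orP [/eqP [-> ->]|/andP [_ /(pd_staircase hP)] //].
by case: rect => _ [_ /andP []].
Qed.

Let mirror_lt r s : r < n -> (mirror a b c d (r, s)).1 < n.
Proof.
by rewrite /mirror => ltr; have := ltn_ord a; have := ltn_ord b; do ?case: ifP.
Qed.

Lemma chute_reduced : reduced_pipedream w P'.
Proof.
apply/(reduced_pipedreamE stair'); split=> [p|p q r s r' s' ne cr cr'].
  by rewrite (labels_chute box crosses_chute).2 // top_pipe_chute_out //; lia.
have ltr : r < n by have := crosses_stair stair' cr.1; lia.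
have ltr' : r' < n by have := crosses_stair stair' cr'.1; lia.
have [e1 e2] := once ne (iffLR (mirrored _ _ _ ltr) cr) (iffLR (mirrored _ _ _
  ltr') cr').
have : mirror a b c d (r, s) = mirror a b c d (r', s').
  by rewrite [LHS]surjective_pairing e1 e2 -surjective_pairing.
by move/(can_inj (mirrorK ltab ltcd)) => -[].
Qed.

Let chute_crossing r s p q : r < n -> crossing n X r s p q ->
  crossing n X' (mirror a b c d (r, s)).1 (mirror a b c d (r, s)).2 p q.
Proof.
move=> ltr cr; apply/mirrored; first exact: mirror_lt.
by rewrite -surjective_pairing (mirrorK ltab ltcd).
Qed.

(** Rows are numbered from 0 and entries from 1, so that the entry at (i, j)
    changes from [a.+1] to [b.+1].  The values strictly between them occur in
    column [j] above row [i], because the pipes that traverse the rectangle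
    horizontally are smaller than [i]. *)
Lemma chute_phi : i < j -> tableau_chute i j (phi w P) (phi w P').
Proof.
move=> ltij.
have hP' := chute_reduced.
have ltbn := ltn_ord b.
have Xas s : c < s <= d -> X a s by move=> hs; apply: (box_crosses box); lia.
have Xbs s : c < s < d -> X b s by move=> hs; apply: (box_crosses box); lia.
have Tij : phi w P i j = a.+1.
  apply: (phi_crossing hP ltij (c := d)); split; first by apply: Xas; lia.
  by left; rewrite (left_pipe_top box) ?(top_pipe_right box) //; lia.
have T'ij : phi w P' i j = b.+1.
  apply: (phi_crossing hP' ltij (c := c)); apply/mirrored => //.
  rewrite /mirror !eqxx !ltnn !andbF !andFb /=; split; first by apply: Xas; lia.
  by left; rewrite (left_pipe_top box) ?(top_pipe_right box) //; lia.
have upab s : c < s < d -> top_pipe n X a.+1 s = top_pipe n X b.+1 s.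
  by move=> hs; rewrite (top_pipe_column box) 1?top_pipeE ?Xbs; lia.
split=> //; first split.
- split; first by rewrite Tij T'ij.
  move=> r ltri; rewrite T'ij => Trj.
  have [_ [s [Xs _ us]]] := phi_row hP Trj.
  have e : s = c.
    apply: (top_pipe_inj stair once (r := b.+1));
      rewrite ?us ?(box_right_pipe box) //.
      by have := stair Xs; lia.
    by case: rect => _ [_ /andP [_ lt]] _ _ _; lia.
  by have := box_bottom_left box; rewrite -e Xs.
- move=> m; rewrite T'ij Tij => -[]; case: m => // m ltam free.
  rewrite leqNgt; apply/negP => ltmb.
  have Xmd : X m d by apply: (box_crosses box); lia.
  have Xmc : X m c by apply: (box_crosses box); lia.
  have lti : left_pipe n X m d < i.
    rewrite -(@left_pipe_run _ _ m c d _ c); first last; try lia.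
      by move=> s hs; apply: (box_crosses box); lia.
    by have := cross_lt stair once Xmc; rewrite (top_pipe_left box); lia.
  have ltn' : left_pipe n X m d < n by have := ltn_ord i; lia.
  apply: (free (Ordinal ltn')) => //.
  apply: (phi_crossing hP (c := d)) => /=; first lia.
  by split=> //; left; rewrite (top_pipe_right box) //; lia.
pose inK (k : 'I_n) (s : 'I_n) := (c < s < d) && (top_pipe n X a.+1 s == k).
exists [set k | [exists s, inK k s]]; split.
  move=> k; rewrite inE => /existsP [s /andP [hs /eqP us]].
  have Xs := Xas s (ltac:(lia)); have Xs' := Xbs s hs.
  have ltjk : j < k.
    by have := cross_lt stair once Xs'; rewrite (left_pipe_bottom box) -?upab
      ?us; lia.
  have ltik : i < k by lia.
  rewrite Tij T'ij; split=> //.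
  - apply: (phi_crossing hP ltik (c := s)); split=> //; left.
    by rewrite (left_pipe_top box); lia.
  - apply: (phi_crossing hP' ltjk (c := s)); apply/mirrored => //.
    rewrite /mirror !ltnn hs !eqxx !andFb /=; split=> //; left.
    by rewrite (left_pipe_bottom box) -?upab; lia.
  - apply: (phi_crossing hP ltjk (c := s)); split=> //; left.
    by rewrite (left_pipe_bottom box) -?upab; lia.
  apply: (phi_crossing hP' ltik (c := s)); apply/mirrored => //.
  rewrite /mirror !ltnn hs eqxx !andbF (gtn_eqF ltab) /=; split=> //; left.
  by rewrite (left_pipe_top box); lia.
move=> h l nij nK.
case ET: (phi w P h l) => [|r].
  case ET': (phi w P' h l) => [//|r'].
  have inv := it_inversion (phi_tableau hP') (i := h) (j := l);
    rewrite ET' in inv.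
  by have := it_shaded (phi_tableau hP) (inv isT); rewrite ET.
have [lthl [s [Xs eh el]]] := phi_row hP ET.
have ltr : r < n by have := stair Xs; lia.
have cr : crossing n X r s h l by split=> //; left.
rewrite (phi_crossing hP' lthl (chute_crossing ltr cr)); congr _.+1.
rewrite /mirror; case: ifP => // _; case: ifP => [/andP [hs rE]|_].
  have lts : s < n by have := ltn_ord d; lia.
  case: nK; case/orP: rE => /eqP rE; rewrite {}rE in eh el.
    split; [left; apply: val_inj; rewrite /= -eh (left_pipe_top box) //; lia|].
    by rewrite inE; apply/existsP; exists (Ordinal lts);
      rewrite /inK hs el eqxx.
  split; [right; apply: val_inj; rewrite /= -eh (left_pipe_bottom box) //;
    lia|].
  by rewrite inE; apply/existsP; exists (Ordinal lts);
    rewrite /inK hs /= upab ?el.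
case: ifP => [/andP [/eqP rE /eqP sE]|_].
  by have := box_bottom_left box; rewrite -rE -sE Xs.
case: ifP => [/andP [/eqP rE /eqP sE]|_] //.
case: nij; congr pair; apply: val_inj; rewrite /= -?eh -?el rE sE.
  by rewrite (left_pipe_top box) //; lia.
by rewrite (top_pipe_right box) //; lia.
Qed.

End PipedreamChute.

(** * Chute moves on tableaux *)

Section TableauChute.

Variables (n : nat) (w : 'S_n) (P : pipedream n) (T' : 'M[nat]_n) (i j : 'I_n).
Hypotheses (hP : reduced_pipedream w P) (hT' : inversions_tableau w T').
Hypothesis chute : tableau_chute i j (phi w P) T'.

Notation X := (crosses P).
Notation T := (phi w P).
Let hT := phi_tableau hP.
Let stair := crosses_stair (pd_staircase hP).
Let once := proj2 (iffLR (reduced_pipedreamE (pd_staircase hP) w) hP).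

(** In a cross the smaller pipe is horizontal, so [T h p] says where pipe [p] is
    vertical. *)
Lemma phi_vertical (h p : 'I_n) r x : T h p = r.+1 -> x + r < n ->
  top_pipe n X r x = p ->
  [/\ X r x, left_pipe n X r x = h & top_pipe n X r.+1 x = p].
Proof.
move=> Thp ltx ex; have [_ [y [Xy eh ep]]] := phi_row hP Thp.
have lty := stair Xy.
have ey : top_pipe n X r y = p by rewrite top_pipeE ?Xy; lia.
suff -> : x = y by [].
by apply: (top_pipe_inj stair once (r := r)); rewrite ?ex ?ey //; lia.
Qed.

(** A pipe that is crossed by a smaller one in each of consecutive rows goes
    straight up through them. *)
Lemma phi_chain (p : 'I_n) a b x : top_pipe n X a.+1 x = p -> x + a.+1 < n ->
    (forall r, a < r < b -> exists h, T h p = r.+1) ->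
  forall r, a < r <= b -> top_pipe n X r x = p /\ x + r < n.
Proof.
move=> ep ltx col; elim=> // r IHr hr.
case: (ltngtP a r) hr => [ltar hr|ltra|<- //]; last by lia.
have [er ltr] : top_pipe n X r x = p /\ x + r < n by apply: IHr; lia.
have [h Thp] : exists h, T h p = r.+1 by apply: col; lia.
have [Xrx _ eS] := phi_vertical Thp ltr er.
by split=> //; have := stair Xrx; lia.
Qed.

(** The rectangle has rows a and b, for the entries [a.+1] and [b.+1] of the two
    tableaux at (i, j); d is the column of the crossing of [i] and [j], and c
    is the column in which [i] turns right into row a.  The triples of both
    tableaux show that every pipe [h] that crosses [j] between the two rows
    crosses, in the same row, also [i] and all the pipes [k] that leave row a
    between c and d. *)
Lemma tableau_chute_rectangle : exists a b c d, chute_rectangle P i j a b c d.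
Proof.
case: chute => ltij [[ltTT' free] least] [K [inK outK]].
have ltK k : k \in K -> j < k by case/inK.
have out h l : (h, l) <> (i, j) -> ~ ((h = i \/ h = j) /\ l \in K) ->
  T' h l = T h l.
  by move=> h1 h2; rewrite outK.
have out_row h l : h != i -> h != j -> T' h l = T h l.
  move=> hi hj; apply: out => [[eh _]|[[] eh _]]; move: hi hj.
  - by rewrite eh eqxx.
  - by rewrite eh eqxx.
  by rewrite eh eqxx.
have out_col (h l : 'I_n) : l <= j -> (h, l) <> (i, j) -> T' h l = T h l.
  by move=> lelj ne; apply: out => // -[_ /ltK]; lia.
have posT : 0 < T i j.
  have : 0 < T' i j by apply: leq_trans ltTT'.
  by move/(it_inversion hT')/(it_shaded hT)/andP => [].
have [a Tij] : exists a, T i j = a.+1 by exists (T i j).-1; lia.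
have [b T'ij] : exists b, T' i j = b.+1 by exists (T' i j).-1; lia.
have leTi := it_row_bound hT' ltij.
rewrite Tij T'ij in ltTT' free least leTi inK.
have ltab : a < b by lia.
have lebi : b <= i by lia.
have ltbn : b < n by have := ltn_ord i; lia.
have ltan : a < n by lia.
(* No entry of column j of T is b.+1: it would also be in column j of T', where
   (i, j) has that value. *)
have not_b h : T h j <> b.+1.
  move=> Thj; have nhi : h <> i by move=> e; move: Thj; rewrite e Tij; lia.
  have eT : T' i j = T' h j.
    by rewrite (out_col h) //; [rewrite Thj T'ij | case].
  by have := it_column_inj hT' (ltac:(rewrite T'ij; done) :
    0 < T' i j) eT => /esym.
have [_ [d [Xad lad uad]]] := phi_row hP Tij.
have ltad := stair Xad.
have col_j r : a < r < b -> exists h : 'I_n, h < i /\ T h j = r.+1.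
  move=> hr; have [/existsP [h /andP [hi /eqP e]]|no] :=
    boolP [exists h : 'I_n, (h < i) && (T h j == r.+1)]; first by exists h.
  have : b.+1 <= r.+1; last by lia.
  apply: least; split; first lia.
  by move=> h hi e; case/existsP: no; exists h; rewrite hi e eqxx.
(* T(h, j) = r.+1 lies between T(h, i) and a.+1, and in T' between T(h, i) and
   b.+1; as r is strictly between a and b, this leaves only T(h, i) = r.+1. *)
have col_i r (h : 'I_n) : a < r < b -> h < i -> T h j = r.+1 -> T h i = r.+1.
  move=> hr hi Thj.
  have t1 := it_triple hT (ltac:(rewrite hi; exact ltij) : h < i < j).
  have t2 := it_triple hT' (ltac:(rewrite hi; exact ltij) : h < i < j).
  have nhi : h <> i by move=> e; rewrite e ltnn in hi.
  have e1 : T' h j = T h j by apply: out_col => // -[].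
  have e2 : T' h i = T h i by apply: out_col => [|[/nhi]] //; lia.
  by move: t1 t2; rewrite /between e1 e2 Thj Tij T'ij; lia.
have Tcol_j r : a < r < b -> exists h : 'I_n, T h j = r.+1.
  by case/col_j=> h [_ e]; exists h.
have ltda : d + a.+1 < n by lia.
have down_j := phi_chain uad ltda Tcol_j.
have [ubd ltdb] : top_pipe n X b d = j /\ d + b < n by apply: down_j; lia.
have Xbd : ~~ X b d.
  apply/negP => Xbd; have lt := cross_lt stair once Xbd.
  have uSb : top_pipe n X b.+1 d = j by move: ubd; rewrite top_pipeE // Xbd.
  have lth : left_pipe n X b d < n by have := ltn_ord j; lia.
  apply: (not_b (Ordinal lth)); apply: (phi_crossing hP (c := d)) => /=;
    first by rewrite -uSb.
  by split=> //; left.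
have lbd : left_pipe n X b d = j by move: ubd;
  rewrite top_pipeE // (negbTE Xbd).
(* If i entered the grid in row a it would be a itself, but a < b <= i. *)
have [full|[c [ltcd Xac run]]] := last_gap (X a) d.
  have : left_pipe n X a 0 = left_pipe n X a d by apply:
    (@left_pipe_run n X a 0 d) => // s /full.
  by rewrite lad left_pipe0; lia.
have la s : c < s <= d -> left_pipe n X a s = i.
  by move=> hs; rewrite (@left_pipe_run _ _ _ c.+1 d) // => [s' hs'|]; apply:
    run.
have uac : top_pipe n X a.+1 c = i.
  by rewrite -(la c.+1) ?left_pipeS ?(negbTE Xac); lia.
have ltca : c + a.+1 < n by lia.
have Tcol_i r : a < r < b -> exists h : 'I_n, T h i = r.+1.
  by move=> hr; have [h [hi e]] := col_j r hr; exists h; apply: col_i hr hi e.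
have down_i := phi_chain uac ltca Tcol_i.
(* Pipe k is to the left of j at the top of row a.  If k < j then the triple
   (i, k, j) of T' fails; if j < k and k is not in K, the triple (i, j, k) of T'
   gives k the same row for its crossings with i and with j. *)
have above_in_K s (k : 'I_n) : c < s < d -> top_pipe n X a.+1 s = k ->
    [/\ j < k, T i k = a.+1 & k \in K].
  move=> hs ek; have Xas := run s hs; have lts := stair Xas.
  have ltik : i < k by have := cross_lt stair once Xas; rewrite la ?ek; lia.
  have Tik : T i k = a.+1.
    by apply: (phi_crossing hP ltik (c := s)); split=> //; left; rewrite la //;
      lia.
  have us : top_pipe n X a s = k by rewrite top_pipeE // Xas.
  have ud : top_pipe n X a d = j by rewrite top_pipeE // Xad.
  have ltsa : s + a < n by lia. have ltda' : d + a < n by lia.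
  case: (ltngtP k j) => [ltkj|ltjk|/val_inj ekj]; last first.
  - have : s = d by apply: (top_pipe_inj stair once (r := a));
      rewrite ?us ?ud ?ekj.
    by lia.
  - have Tjk := phi_order hP ltjk ltda' ltsa ud us.
    split=> //; apply/negPn/negP => nk.
    have e1 : T' i k = T i k.
      apply: out => [[e]|[_ kK]]; first by rewrite e ltnn in ltjk.
      by rewrite kK in nk.
    have e2 : T' j k = T j k.
      apply: out => [[e _]|[_ kK]]; first by rewrite e ltnn in ltij.
      by rewrite kK in nk.
    have := it_triple hT' (ltac:(rewrite ltij; exact ltjk) : i < j < k).
    rewrite /between e1 e2 Tik T'ij => btw.
    have eT : T i k = T j k by lia.
    have pos : 0 < T i k by rewrite Tik.
    by have eij := it_column_inj hT pos eT; rewrite eij ltnn in ltij.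
  have Tkj := phi_order hP ltkj ltsa ltda' us ud.
  have e1 : T' i k = T i k.
    by apply: out_col => [|[e]]; [lia | rewrite e ltnn in ltkj].
  have e2 : T' k j = T k j.
    by apply: out_col => // -[e]; rewrite e ltnn in ltik.
  have := it_triple hT' (ltac:(rewrite ltik; exact ltkj) : i < k < j).
  by rewrite /between e1 e2 Tik T'ij; lia.
have down_k s (k : 'I_n) : c < s < d -> top_pipe n X a.+1 s = k ->
    forall r, a < r < b -> exists h : 'I_n, T h k = r.+1.
  move=> hs ek r hr; have [ltjk Tik kK] := above_in_K s k hs ek.
  have [h [hi Thj]] := col_j r hr; exists h.
  have Thi := col_i r h hr hi Thj.
  have ltik : i < k by lia.
  have t1 := it_triple hT (ltac:(rewrite hi; exact ltik) : h < i < k).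
  have t2 := it_triple hT' (ltac:(rewrite hi; exact ltik) : h < i < k).
  have nhi : h != i by apply: contraTN hi => /eqP ->; rewrite ltnn.
  have nhj : h != j by apply: contraTN (ltn_trans hi ltij) => /eqP ->;
    rewrite ltnn.
  have [_ _ _ _ T'ik] := inK k kK.
  by move: t1 t2; rewrite /between (out_row h k) // (out_row h i) // Thi Tik
    T'ik; lia.
have cross_col s (k : 'I_n) : c < s < d -> top_pipe n X a.+1 s = k ->
    (forall r, a < r < b -> X r s) /\ X b s.
  move=> hs ek; have lts : s + a.+1 < n by lia.
  have ch := phi_chain ek lts (down_k s k hs ek); split=> [r hr|].
    have [er ltr] : top_pipe n X r s = k /\ s + r < n by apply: ch; lia.
    have [h Thk] := down_k s k hs ek r hr.
    by case: (phi_vertical Thk ltr er).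
  have [eb ltb] : top_pipe n X b s = k /\ s + b < n by apply: ch; lia.
  have [_ _ kK] := above_in_K s k hs ek; have [_ _ _ Tjk _] := inK k kK.
  by case: (phi_vertical Tjk ltb eb).
have inner s : c < s < d -> (forall r, a < r < b -> X r s) /\ X b s.
  move=> hs; have Xas := run s hs; have lts := stair Xas.
  have ltk : top_pipe n X a.+1 s < n.
    by have := @top_pipe_bounds n X stair a.+1 s; lia.
  exact: (cross_col s (Ordinal ltk) hs erefl).
have Xcd r s : a < r < b -> s = c \/ s = d -> X r s.
  move=> hr; case=> ->.
    have [er ltr] : top_pipe n X r c = i /\ c + r < n by apply: down_i; lia.
    by have [h e] := Tcol_i r hr; case: (phi_vertical e ltr er).
  have [er ltr] : top_pipe n X r d = j /\ d + r < n by apply: down_j; lia.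
  by have [h e] := Tcol_j r hr; case: (phi_vertical e ltr er).
have [ubc ltcb] : top_pipe n X b c = i /\ c + b < n by apply: down_i; lia.
have lbS : left_pipe n X b c.+1 = j.
  rewrite -lbd (@left_pipe_run _ _ _ c.+1 d) //; last lia.
  by move=> s hs; case: (inner s hs).
(* Otherwise j would cross the smaller pipe i horizontally. *)
have Xbc : ~~ X b c.
  apply/negP => Xbc; have lt := cross_lt stair once Xbc.
  move: ubc; rewrite top_pipeE // Xbc.
  by move: lbS; rewrite left_pipeS Xbc; lia.
have lbc : left_pipe n X b c = i by move: ubc;
  rewrite top_pipeE // (negbTE Xbc).
have uSbc : top_pipe n X b.+1 c = j by move: lbS;
  rewrite left_pipeS (negbTE Xbc).
have ltcn : c < n by lia. have ltdn : d < n by lia.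
exists (Ordinal ltan), (Ordinal ltbn), (Ordinal ltcn), (Ordinal ltdn).
split=> //; rewrite /is_bump /is_elbow -?crossesE /=.
- by split; apply/andP; split=> //; lia.
- by rewrite Xbd /=; lia.
- move=> r s hr hs; rewrite !inE !xpair_eqE -!val_eqE /= -crossesE => ne.
  have [ra|[rb|rab]] : r = a :> nat \/ r = b :> nat \/ a < r < b by lia.
  + have [->|hs'] : s = d :> nat \/ c < s < d by lia.
      by rewrite ra.
    by rewrite ra; apply: run.
  + by rewrite rb; case: (inner s) => //; lia.
  have [hs'|hs'] : (s = c :> nat \/ s = d :> nat) \/ c < s < d by lia.
    exact: Xcd.
  by case: (inner s hs') => h _; apply: h.
split; apply/(pipe_entersE (pd_staircase hP)) => //=; lia.
Qed.

End TableauChute.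

Theorem proposition6p3 (n : nat) (w : 'S_n) (T : 'M[nat]_n) (i j : 'I_n)
    (hT : inversions_tableau w T) (hij : i < j)
    (P : pipedream n) (hP : reduced_pipedream w P) (hPT : phi w P = T) :
  (is_tableau_chute w i j T <-> is_pipedream_chute i j P) /\
  (forall T' : 'M[nat]_n, inversions_tableau w T' -> tableau_chute i j T T' ->
     forall P' : pipedream n,
       (reduced_pipedream w P' /\ phi w P' = T') <-> pipedream_chute i j P P').
Proof.
have chuteP P' : pipedream_chute i j P P' ->
    reduced_pipedream w P' /\ tableau_chute i j T (phi w P').
  case=> _ [a [b [c [d [rect ->]]]]].
  by split; [apply: (chute_reduced hP rect) | rewrite -hPT; apply: chute_phi].
have chuteT T' : inversions_tableau w T' -> tableau_chute i j T T' ->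
    exists P', pipedream_chute i j P P'.
  rewrite -hPT => hT' ch.
  have [a [b [c [d rect]]]] := tableau_chute_rectangle hP hT' ch.
  by exists ((b, c) |: (P :\ (a, d))); split=> //; exists a, b, c, d.
split; first split.
- by case=> T' hT' /(chuteT _ hT').
- case=> P' /chuteP [hP' ch]; exists (phi w P') => //; exact: phi_tableau.
move=> T' hT' ch.
have phi_chute Q : pipedream_chute i j P Q ->
  reduced_pipedream w Q /\ phi w Q = T'.
  move=> /chuteP [hQ chQ]; split=> //.
  exact: tableau_chute_uniq (phi_tableau hQ) hT' chQ ch.
move=> P'; split=> [[hP' eT']|/phi_chute //].
have [Q chQ] := chuteT T' hT' ch; have [hQ eQ] := phi_chute Q chQ.
by rewrite (phi_inj hP' hQ) // eT' eQ.
Qed.
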